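(* $$m^{\frac{d-1}{d+1}}\ll \log a(d,m),$$ that is, for a fixed positive integer $d$ there is a suitable constant $c_d$, depending only on $d$, such that $$m^{\frac{d-1}{d+1}}\leqslant c_d\cdot\log a(d,m)$$ holds for all positive integers $m$.
   Context: A convex lattice polytope in $d$-dimensional space is the convex hull of a finite subset of the integer lattice $\mathbb{Z}^d$; the polytopes considered are $d$-dimensional, and $\mathrm{vol}$ denotes volume. Two $d$-dimensional convex lattice polytopes $P_1$ and $P_2$ are affinely equivalent if there is an affine transformation $\tau$ with $\tau(P_1)=P_1A+\mathbf{v}=P_2$, where $A\in\mathbb{R}^{d\times d}$ and $\mathbf{v}\in\mathbb{R}^d$. For a $d$-dimensional convex lattice polytope $P$, $\mathcal{A}(P)$ denotes the set of convex lattice polytopes affinely equivalent to $P$, and $V_{min}(\mathcal{A}(P)):=\min\{\mathrm{vol}(R):\ R\in\mathcal{A}(P)\}$ (this minimum exists and is attained, because the volume of every $d$-dimensional convex lattice polytope is a positive integer multiple of $1/d!$). For positive integers $d$ and $m$, $$a(d,m):=\bigl|\{\mathcal{A}(P):\ V_{min}(\mathcal{A}(P))=m/d!\}\bigr|,$$ the number of affine equivalence classes of $d$-dimensional convex lattice polytopes whose minimal volume is $m/d!$. For functions $f(d,m)$ and $g(d,m)$ of positive integers $d$ and $m$, $f(d,m)\ll g(d,m)$ means that $f(d,m)\leqslant c_d\cdot g(d,m)$ holds for all positive integers $m$ and a fixed positive integer $d$, where $c_d$ is a suitable constant that depends only on $d$.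
   Formalization: Proved for d at least 2 and all m at least some m_0 depending only on d, instead of all positive d and m: the inequality fails at m = 1, where a(d,1) = 1 and the logarithm is 0, and for d = 1 it fails or is undefined for every m. *)

(* Defs.v *)
From HB Require Import structures.
From mathcomp Require Import all_boot all_order all_algebra finmap.
From mathcomp Require Import all_classical all_reals all_analysis.

Set Implicit Arguments.
Unset Strict Implicit.
Unset Printing Implicit Defensive.

Import Order.TTheory GRing.Theory Num.Theory.
Import numFieldNormedType.Exports.

Local Open Scope classical_set_scope.
Local Open Scope ring_scope.

(* d-dimensional Lebesgue measure, integrated one coordinate at a time: the
   successor case is what the product measure of [lebesgue_measure] and [vol d]
   unfolds to. It agrees with Lebesgue measure on Borel sets, in particular on
   polytopes. *)
Fixpoint vol (R : realType) (d : nat) : set 'rV[R]_d -> \bar R :=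
  match d return set 'rV[R]_d -> \bar R with
  | 0%N => fun A => (\1_A (0 : 'rV[R]_0))%:E
  | d'.+1 => fun A =>
      (\int[@lebesgue_measure R]_x
         vol [set y : 'rV[R]_d' | A (row_mx (x%:M : 'rV[R]_1) y)])%E
  end.

Definition conv_hull (R : realType) (d : nat) (X : set 'rV[R]_d) : set 'rV[R]_d :=
  smallest (@convex_set R 'rV[R]_d) X.

(* [p] and the points [p + row i M] are d + 1 affinely independent points. *)
Definition full_dimensional (R : realType) (d : nat) (P : set 'rV[R]_d) : Prop :=
  exists (p : 'rV[R]_d) (M : 'M[R]_d),
    [/\ P p, forall i, P (p + row i M) & M \in unitmx].

(* Convex lattice polytopes, always of full dimension d. *)
Definition lattice_polytope (R : realType) (d : nat) (P : set 'rV[R]_d) : Prop :=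
  (exists X : set 'rV[R]_d,
     [/\ finite_set X, forall x, X x -> x \is a mxOver Num.int &
         P = conv_hull X]) /\
  full_dimensional P.

(* [A] need not be assumed invertible: between full-dimensional sets it is. *)
Definition affinely_equivalent (R : realType) (d : nat) (P Q : set 'rV[R]_d) : Prop :=
  exists (A : 'M[R]_d) (v : 'rV[R]_d), [set x *m A + v | x in P] = Q.

Definition affine_class (R : realType) (d : nat) (P : set 'rV[R]_d) :
    set (set 'rV[R]_d) :=
  [set Q | lattice_polytope Q /\ affinely_equivalent P Q].

Definition is_min_vol (R : realType) (d : nat) (C : set (set 'rV[R]_d)) (v : \bar R) :
    Prop :=
  (exists2 Q, C Q & vol Q = v) /\ forall Q, C Q -> (v <= vol Q)%E.

(* [fset_set] sends an infinite set to the empty one, so the count would be 0 if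
   there were infinitely many classes. *)
Definition num_classes (R : realType) (d m : nat) : nat :=
  #|` fset_set [set affine_class P | P in
        [set P : set 'rV[R]_d | lattice_polytope P /\
           is_min_vol (affine_class P) (m%:R / (d`!)%:R)%:E]] |%fset.

(* Main.v *)
(* Write d = k + 1 and n = 2L. Over the box [0, n]^k, bound a region from below by
   the sum of the piecewise linear interpolations of t(t-1)/2 in each coordinate
   and from above by a horizontal hyperplane of height of order L^2. All of the
   lattice_pts points of the lower boundary are vertices. Fix order L^k of them, no two
   of which are neighbours; cutting off any subset S of them leaves a lattice_pts
   polytope, and each cut removes the same volume, from disjoint places. The volume
   is then of order L^(k+2) and differs from a prescribed m/d! by less than L^d/d!
   once the height is chosen; writing this excess in base L, its d digits are
   removed by cutting one simplex off each of d top_height corners. So there are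
   2^(c L^k) polytopes of volume exactly m/d! with m of order L^(k+2).
   The points 0, e_i and 2 e_1 + e_d are vertices forming a unimodular frame, so an
   affine image which is a lattice_pts polytope has an integral linear part, hence at
   least the same volume; and an affine map between two polytopes of the family is
   determined by lattice_pts points in a box of polynomial size, so that each class
   contains only polynomially many of them.
   The classes of minimal volume m/d! are finitely many: in barycentric coordinates
   with respect to a simplex of lattice_pts points, all lattice_pts points of the polytope
   have coordinates a/e with |a|, e <= m. *)

Require Import Defs.
From HB Require Import structures.
From mathcomp Require Import all_boot all_order all_algebra finmap.
From mathcomp Require Import all_classical all_reals all_analysis.
From mathcomp Require Import measurable_realfun.
From mathcomp Require Import ring lra zify.

Set Implicit Arguments.
Unset Strict Implicit.
Unset Printing Implicit Defensive.

Import Order.TTheory GRing.Theory Num.Theory.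
Import numFieldNormedType.Exports.

Local Open Scope classical_set_scope.
Local Open Scope ring_scope.

(** * Volume as a product measure *)

(** The exponent comes from two scales: the volume has order L^(k+2), only order L^k lower vertices
    can be cut freely, and k/(k+2) = (d-1)/(d+1). The polynomial multiplicity of a class costs only
    a multiple of log L. The obstacle is that the volume is prescribed exactly, while removing S
    changes it. All site caps have equal volume, so the loss depends on the cardinality of S alone,
    and height and corner cuts can be chosen as functions of that cardinality. The function t(t-1)/2
    is taken because it is integral at integers and its slope jumps by 1 at each interior integer:
    after a shear, the region near a lifted lattice point is always the same cone over a
    cross-polytope, and the cap removed there ends exactly at the lifted neighbours. Only vertices
    of a polytope are known to go to lattice points under an affine map onto a lattice polytope.
    Hence the frame must consist of vertices, and no cut may touch it. *)

Definition coord_gen (R : realType) (d : nat) : set (set 'rV[R]_d) :=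
  [set X | exists (i : 'I_d) (B : set R), measurable B /\
     X = [set x : 'rV[R]_d | B (x 0 i)]].

Arguments coord_gen : clear implicits.

(** With the sigma-algebra generated by the coordinates, measurability of a map into rows is checked
    coordinate by coordinate. *)
Notation rowm R d := (g_sigma_algebraType (coord_gen R d)).

Lemma sigma_finite_prod d1 d2 (T1 : measurableType d1) (T2 : measurableType d2)
    (R : realType) (m1 : {sigma_finite_measure set T1 -> \bar R})
    (m2 : {sigma_finite_measure set T2 -> \bar R}) :
  sigma_finite setT (m1 \x m2)%E.
Proof.
have /sigma_finiteP[F [UF ndF Ffin]] := sigma_finiteT m1.
have /sigma_finiteP[G [UG ndG Gfin]] := sigma_finiteT m2.
exists (fun n => F n `*` G n).
  apply/esym/seteqP; split => // -[x y] _.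
  have : [set: T1] x by [].
  have : [set: T2] y by [].
  rewrite UF UG => -[n _ Gy] [k _ Fx]; exists (maxn n k) => //; split.
    by move: x Fx; exact/subsetPset/ndF/leq_maxr.
  by move: y Gy; exact/subsetPset/ndG/leq_maxl.
move=> n; have [mF F_fin] := Ffin n; have [mG G_fin] := Gfin n.
split; first exact: measurableX.
by rewrite product_measure1E// lte_mul_pinfty// ge0_fin_numE.
Qed.

Section SF.
Context d (T : measurableType d) (R : realType)
    (m : {measure set T -> \bar R}) (sf : sigma_finite setT m).
(** A copy of [m] indexed by the proof of sigma-finiteness, so that this proof can be attached to it
    as a canonical structure. *)
Definition sf_measure (_ : sigma_finite setT m) : set T -> \bar R := m.
HB.instance Definition _ := Measure.on (sf_measure sf).
HB.instance Definition _ := Measure_isSigmaFinite.Build _ _ _ (sf_measure sf) sf.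
End SF.
Lemma sigma_finite_pack d (T : measurableType d) (R : realType)
    (m : {measure set T -> \bar R}) : sigma_finite setT m ->
  exists m' : {sigma_finite_measure set T -> \bar R}, forall A, m' A = m A.
Proof.
move=> sf.
by exists (sf_measure sf).
Qed.

Section Rows.
Variable R : realType.
Notation lam := (@lebesgue_measure R).

Lemma measurable_coord d (i : 'I_d) :
  measurable_fun setT (fun x : rowm R d => (x : 'rV_d) 0 i : measurableTypeR R).
Proof.
move=> _ B mB; rewrite setTI; apply: sub_sigma_algebra.
by exists i, B.
Qed.

Lemma measurable_fun_row d' (T : measurableType d') d (f : T -> rowm R d) :
  (forall i, measurable_fun setT (fun x => (f x : 'rV_d) 0 i : measurableTypeR R)) ->
  measurable_fun setT f.
Proof.
move=> mf; apply: (@measurability _ _ T (rowm R d) setT f (coord_gen R d)) => //.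
move=> _ [_ [i [B [mB ->]]] <-].
exact: mf.
Qed.

Definition cons_row d (p : R * 'rV[R]_d) : 'rV[R]_d.+1 :=
  row_mx (p.1%:M : 'rV_1) p.2.

Lemma cons_row0 d (p : R * 'rV[R]_d) : cons_row p 0 0 = p.1.
Proof.
rewrite /cons_row mxE; case: splitP => // j _; by rewrite mxE ord1 eqxx mulr1n.
Qed.

Lemma cons_rowS d (p : R * 'rV[R]_d) i : cons_row p 0 (lift 0 i) = p.2 0 i.
Proof.
rewrite /cons_row mxE; case: splitP => [j|j /= E].
  by rewrite ord1.
by congr (_ _ _); apply/val_inj => /=; move: E; rewrite /bump /= => -[].
Qed.

Lemma measurable_cons_row d :
  measurable_fun setT (fun p : measurableTypeR R * rowm R d => cons_row p : rowm R d.+1).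
Proof.
apply: measurable_fun_row => i.
case: (unliftP ord0 i) => [j|] ->.
  under eq_fun do rewrite cons_rowS.
  by apply: (measurableT_comp (measurable_coord _)) => //.
under eq_fun do rewrite cons_row0.
exact: measurable_fst.
Qed.

Lemma vol_cons d (A : set 'rV[R]_d.+1) :
  vol A = (\int[lam]_x vol [set y | A (cons_row (x, y))])%E.
Proof. by []. Qed.

Lemma cons_row_split d (x : 'rV[R]_d.+1) :
  x = cons_row (x 0 0, \row_i x 0 (lift 0 i)).
Proof.
apply/rowP => i; case: (unliftP ord0 i) => [j|] ->.
  by rewrite cons_rowS mxE.
by rewrite cons_row0.
Qed.

Lemma measurable_slice d (A : set (rowm R d.+1)) (x : R) : measurable A ->
  measurable ([set y | A (cons_row (x, y))] : set (rowm R d)).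
Proof.
move=> mA; rewrite -[X in measurable X]setTI.
apply: (measurableT_comp (@measurable_cons_row d) (pair1_measurable x)) => //.
Qed.

(** Additivity and Tonelli's theorem are not visible on iterated integrals. They become available
    because [vol] is the push-forward of a product measure under [cons_row]; sigma-finiteness is
    carried along for the next product. *)
Lemma vol_measure d :
  exists m : {sigma_finite_measure set (rowm R d) -> \bar R},
    forall A : set (rowm R d), measurable A -> vol A = m A.
Proof.
elim: d => [|d [m mE]].
  exists (@dirac _ (rowm R 0) 0 R).
  by move=> A mA /=; rewrite diracE indicE.
pose f (p : measurableTypeR R * rowm R d) : rowm R d.+1 := cons_row p.
have mf : measurable_fun setT f := @measurable_cons_row d.
pose g (x : rowm R d.+1) : measurableTypeR R * rowm R d :=
  (x 0 0, \row_i (x : 'rV_d.+1) 0 (lift 0 i)).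
have mg : measurable_fun setT g.
  apply: measurable_fun_pair; first exact: measurable_coord.
  apply: measurable_fun_row => i; under eq_fun do rewrite mxE.
  exact: measurable_coord.
have gf p : g (f p) = p.
  rewrite /g /f cons_row0; case: p => a b /=; congr pair.
  by apply/rowP => i; rewrite mxE cons_rowS.
have fg x : f (g x) = x by rewrite /f /g -cons_row_split.
have sf : sigma_finite setT (pushforward (lam \x m)%E f).
  have [F UF Ffin] := sigma_finite_prod lam m.
  exists (fun n => g @^-1` F n).
    by rewrite -preimage_bigcup -UF.
  move=> n; have [mFn Fn] := Ffin n; split.
    by rewrite -[X in measurable X]setTI; exact: mg.
  rewrite /pushforward -comp_preimage.
  rewrite (_ : g \o f = id) //; last exact/funext.
pose m' := [the {measure set (rowm R d.+1) -> \bar R} of pushforward (lam \x m)%E f].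
have [m'' mm''] := @sigma_finite_pack _ _ _ (m' mf) sf.
exists m'' => A mA.
rewrite mm'' vol_cons /= /pushforward /product_measure1.
apply: eq_integral => x _ /=.
rewrite mE; last exact: measurable_slice.
congr (m _); apply/seteqP; split => y; by rewrite /xsection /= inE.
Qed.

Lemma measurable_vol_slice d (A : set (rowm R d.+1)) : measurable A ->
  measurable_fun setT
    ((fun x => vol [set y | A (cons_row (x, y))]) : measurableTypeR R -> \bar R).
Proof.
move=> mA; have [m mE] := vol_measure d.
have mfA : measurable ((@cons_row d) @^-1` A : set (measurableTypeR R * rowm R d)).
  rewrite -[X in measurable X]setTI; exact: measurable_cons_row.
apply: (eq_measurable_fun (m \o xsection ((@cons_row d) @^-1` A))).
  move=> x _ /=; rewrite mE; last exact: measurable_slice.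
  congr (m _); apply/seteqP; split => y; by rewrite /xsection /= inE.
exact: measurable_fun_xsection.
Qed.

(** The definition of [vol] puts the first coordinate in the outermost integral; Tonelli's theorem
    moves it to the innermost one, as needed for a shear that displaces only the first
    coordinate. *)
Lemma vol_fubini d : exists m : {sigma_finite_measure set (rowm R d) -> \bar R},
  forall A : set (rowm R d.+1), measurable A ->
  vol A = (\int[m]_y lam [set x | A (cons_row (x, y))])%E.
Proof.
have [m mE] := vol_measure d; exists m => A mA.
have mfA : measurable ((@cons_row d) @^-1` A : set (measurableTypeR R * rowm R d)).
  rewrite -[X in measurable X]setTI; exact: measurable_cons_row.
rewrite vol_cons.
transitivity (\int[lam]_x fubini_F m (EFin \o \1_((@cons_row d) @^-1` A)) x)%E.
  rewrite indic_fubini_tonelli_FE//.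
  apply: eq_integral => x _ /=; rewrite mE; last exact: measurable_slice.
  congr (m _); apply/seteqP; split => y; by rewrite /xsection /= inE.
rewrite (@indic_fubini_tonelli _ _ _ _ R lam m) // indic_fubini_tonelli_GE//.
apply: eq_integral => y _ /=.
congr (lam _); apply/seteqP; split => x; by rewrite /ysection /= inE.
Qed.

Lemma vol_ge0 d (A : set 'rV[R]_d) : (0 <= vol A)%E.
Proof.
elim: d A => [|d IH] A /=; first by rewrite lee_fin.
exact: integral_ge0.
Qed.

(** Uniqueness of Lebesgue measure reduces the claim to intervals ]p, q]. For negative [a] the
    preimage is closed at the other end, with the same length. *)
Lemma lebesgue_affine (a b : R) (A : set R) : a != 0 -> measurable A ->
  lam A = (`|a|%:E * lam ((fun x => a * x + b)%R @^-1` A))%E.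
Proof.
move=> a0 mA.
have mf : measurable_fun setT ((fun x => a * x + b) : measurableTypeR R -> measurableTypeR R).
  apply: measurable_funD => //; exact: measurable_funM.
pose m1 : {measure set (measurableTypeR R) -> \bar R} :=
  mscale (NngNum (normr_ge0 a)) (measure_function_pushforward__canonical__measure_function_Measure lam mf).
change (lam A = m1 A).
apply: lebesgue_measure_unique => // _ [[p q] /= pq <-].
rewrite /m1 /mscale /= /pushforward.
have -> : lam ((fun x : measurableTypeR R => a * x + b) @^-1` `]p, q]) =
    if p < q then ((q - p) / `|a|)%:E else 0%E.
  case: (ltgtP a 0) a0 => // sa _.
    rewrite (_ : _ @^-1` _ = `[(q - b) / a, (p - b) / a[%classic).
      rewrite lebesgue_measure_itv /= lte_fin ltr_nM2r ?invr_lt0// ltrD2r.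
      by case: ifP => // _; rewrite -EFinB ltr0_norm// invrN; congr EFin; field; lra.
    apply/seteqP; split => x /=; rewrite !in_itv /= ler_ndivrMr// ltr_ndivlMr//;
      rewrite lerBrDr ltrBlDr mulrC => /andP[h1 h2]; by rewrite h1 h2.
  rewrite (_ : _ @^-1` _ = `](p - b) / a, (q - b) / a]%classic).
    rewrite lebesgue_measure_itv /= lte_fin ltr_pM2r ?invr_gt0// ltrD2r.
    by case: ifP => // _; rewrite -EFinB gtr0_norm//; congr EFin; field; lra.
  apply/seteqP; split => x /=; rewrite !in_itv /= ltr_pdivrMr// ler_pdivlMr//;
    rewrite ltrBlDr lerBrDr mulrC => /andP[h1 h2]; by rewrite h1 h2.
rewrite lebesgue_measure_itv /= lte_fin; case: ifP => _; last by rewrite mule0.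
rewrite -EFinB -EFinM; congr EFin; rewrite mulrC divfK// normr_eq0//.
Qed.

Lemma ge0_integral_affine (a b : R) (f : measurableTypeR R -> \bar R) : a != 0 ->
  measurable_fun setT f -> (forall x, 0 <= f x)%E ->
  (\int[lam]_x f x = `|a|%:E * \int[lam]_x f (a * x + b)%R)%E.
Proof.
move=> a0 mf f0.
have mg : measurable_fun setT ((fun x => a * x + b) : measurableTypeR R -> measurableTypeR R).
  apply: measurable_funD => //; exact: measurable_funM.
pose g : measurableTypeR R -> measurableTypeR R := fun x => a * x + b.
transitivity (`|a|%:E * \int[pushforward lam g]_x f x)%E; last first.
  by rewrite (ge0_integral_pushforward mg)//.
pose pg : {measure set (measurableTypeR R) -> \bar R} :=
  measure_function_pushforward__canonical__measure_function_Measure lam mg.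
rewrite -(@ge0_integral_mscale _ _ _ pg setT measurableT (NngNum (normr_ge0 a)) f)//.
apply: eq_measure_integral => A mA _.
exact: lebesgue_affine.
Qed.
End Rows.

(** * Affine change of variables *)

Section AffineVolume.
Variable R : realType.
Notation lam := (@lebesgue_measure R).

Lemma measurable_affine d d' (A : 'M[R]_(d, d')) (v : 'rV[R]_d') :
  measurable_fun setT ((fun x => x *m A + v) : rowm R d -> rowm R d').
Proof.
apply: measurable_fun_row => i.
under eq_fun do rewrite !mxE.
apply: measurable_funD => //.
apply: measurable_sum => j; apply: measurable_funM => //.
exact: measurable_coord.
Qed.

Lemma measurable_affine_preimage d d' (A : 'M[R]_(d, d')) (v : 'rV[R]_d')
    (E : set (rowm R d')) : measurable E ->
  measurable ([set x | E (x *m A + v)] : set (rowm R d)).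
Proof.
by move=> mE; rewrite -[X in measurable X]setTI; exact: measurable_affine.
Qed.

Let good d (A : 'M[R]_d) (v : 'rV[R]_d) := forall E : set (rowm R d),
  measurable E -> vol E = (`|\det A|%:E * vol [set x | E (x *m A + v)%R])%E.

Let good_comp d (A B : 'M[R]_d) v w : good A v -> good B w ->
  good (A *m B) (v *m B + w).
Proof.
move=> gA gB E mE; rewrite (gB _ mE) gA; last exact: measurable_affine_preimage.
rewrite det_mulmx muleA -EFinM -normrM mulrC; congr (_ * vol _)%E.
by apply/seteqP; split=> x /=; rewrite mulmxDl mulmxA addrA.
Qed.

Let good_lower d (l : 'cV[R]_d) : @good (1 + d) (block_mx 1%:M 0 l 1%:M) 0.
Proof.
move=> E mE; have [m mP] := vol_fubini R d.
rewrite det_lblock !det1 mulr1 normr1 mul1e (mP _ mE) mP; last first.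
  exact: measurable_affine_preimage.
apply: eq_integral => y _.
rewrite (@lebesgue_affine _ 1 ((y *m l) 0 0)) ?oner_neq0//; last first.
  rewrite -[X in measurable X]setTI.
  apply: (measurableT_comp (@measurable_cons_row R d) (pair2_measurable (y : rowm R d))) => //.
rewrite normr1 mul1e; congr (lam _); apply/seteqP; split => x /=;
  rewrite addr0 /cons_row /= mul_row_block mulmx1 mulmx0 add0r mulmx1;
  by rewrite [y *m l]mx11_scalar -raddfD /= ?mxE eqxx mulr1n mul1r.
Qed.

Let good_upper d (a : R) (u : 'rV[R]_d) (S : 'M[R]_d) (b : R) (v : 'rV[R]_d) :
  a != 0 -> S \in unitmx -> (forall w, good S w) ->
  @good (1 + d) (block_mx a%:M u 0 S) (row_mx b%:M v).
Proof.
move=> a0 uS gS E mE.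
rewrite det_ublock det_scalar1 normrM EFinM !vol_cons -muleA.
rewrite (ge0_integral_affine b a0); last 2 first.
- exact: measurable_vol_slice.
- by move=> x; exact: vol_ge0.
congr (_ * _)%E; rewrite -ge0_integralZl//; last 2 first.
- apply: measurable_vol_slice; exact: measurable_affine_preimage.
- by move=> x _; exact: vol_ge0.
apply: eq_integral => x _.
rewrite (gS (x *: u + v)); last exact: measurable_slice.
congr (_ * vol _)%E; apply/seteqP; split => y /=;
  rewrite /cons_row /= mul_row_block add_row_mx mulmx0 addr0 -scalar_mxM -raddfD /= mulrC;
  by rewrite mul_scalar_mx addrCA addrA.
Qed.

(** Block Gaussian elimination by induction on the dimension: a matrix with nonzero top left entry
    is a unipotent lower block matrix times an upper block matrix whose lower right block is the
    Schur complement. *)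
Lemma vol_affine d (A : 'M[R]_d) (v : 'rV[R]_d) (E : set (rowm R d)) :
  A \in unitmx -> measurable E ->
  vol E = (`|\det A|%:E * vol [set x | E (x *m A + v)%R])%E.
Proof.
move=> uA; move: E; rewrite -/(good A v).
elim: d A v uA => [|d IH] A v uA.
  move=> E mE; rewrite det_mx00 normr1 mul1e; congr vol.
  by apply/seteqP; split => x /=; rewrite [x]thinmx0 [_ + _]thinmx0.
have gpivot (B : 'M[R]_(1 + d)) w : B \in unitmx -> B 0 0 != 0 -> good B w.
  move=> uB B00.
  pose a := B 0 0; pose u := ursubmx B; pose l := a^-1 *: dlsubmx B.
  pose S := drsubmx B - l *m u.
  have aE : ulsubmx B = a%:M.
    rewrite [LHS]mx11_scalar /ulsubmx !mxE; congr (B _ _)%:M; exact/val_inj.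
  have BE : B = block_mx 1%:M 0 l 1%:M *m block_mx a%:M u 0 S.
    rewrite mulmx_block !mul0mx !mul1mx !addr0 -aE -[LHS]submxK.
    congr block_mx; last by rewrite addrC subrK.
    by rewrite aE mul_mx_scalar /l scalerA divff// scale1r.
  have uS : S \in unitmx.
    move: uB; rewrite BE unitmx_mul unitmxE => /andP[_].
    by rewrite unitmxE det_ublock unitrM => /andP[_]; rewrite unitmxE.
  rewrite BE (_ : w = 0 *m block_mx a%:M u 0 S + row_mx (w 0 0)%:M (rsubmx (w : 'rV[R]_(1 + d)))).
    apply: good_comp; first exact: good_lower.
    by apply: good_upper => // w'; exact: IH.
  rewrite mul0mx add0r -[LHS]hsubmxK; congr row_mx.
  rewrite [LHS]mx11_scalar /lsubmx mxE; congr (w _ _)%:M; exact/val_inj.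
pose Lw (l : 'cV[R]_d) : 'M[R]_(1 + d) := block_mx 1%:M 0 l 1%:M.
have LwN l : Lw l *m Lw (- l) = 1%:M.
  rewrite /Lw mulmx_block !(mul1mx, mul0mx, mulmx1, mulmx0) !addr0 add0r subrr.
  by rewrite -scalar_mx_block.
have AL00 l : ((A : 'M[R]_(1 + d)) *m Lw l) 0 0 =
    A 0 0 + \sum_j A 0 (lift 0 j) * l j 0.
  have L00 : Lw l 0 0 = 1.
    transitivity (Lw l (lshift d 0) (lshift d 0)); first by congr (Lw l _ _); exact/val_inj.
    by rewrite block_mxEul mxE.
  have LS j : Lw l (lift 0 j) 0 = l j 0.
    transitivity (Lw l (rshift 1 j) (lshift d 0)); first by congr (Lw l _ _); exact/val_inj.
    by rewrite block_mxEdl.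
  rewrite mxE big_ord_recl; congr (_ + _).
    by transitivity (A 0 0 * Lw l 0 0) => //; rewrite L00 mulr1.
  by apply: eq_bigr => j _; rewrite -LS.
(* If [A 0 0] vanishes, invertibility gives another nonzero entry in the first row; adding its
   column to the first column creates a pivot. *)
have [l Al] : exists l : 'cV[R]_d, ((A : 'M[R]_(1 + d)) *m Lw l) 0 0 != 0.
  have [A00|A00] := eqVneq (A 0 0) 0; last first.
    by exists 0; rewrite AL00 big1 ?addr0// => j _; rewrite mxE mulr0.
  have [j Aj] : exists j, A 0 (lift 0 j) != 0.
    apply: contrapT => /forallNP A0.
    move: uA; rewrite unitmxE (expand_det_row _ 0) big1 ?unitr0// => j _.
    case: (unliftP ord0 j) => [i|] ->; last by rewrite A00 mul0r.
    by have /negP/negPn/eqP -> := A0 i; rewrite mul0r.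
  exists (delta_mx j 0).
  rewrite AL00 A00 add0r (bigD1 j) //= big1 => [|i ij]; last first.
    by rewrite mxE (negbTE ij) mulr0.
  by rewrite mxE !eqxx mulr1 addr0.
have AE : A = ((A : 'M[R]_(1 + d)) *m Lw l) *m Lw (- l).
  by rewrite -mulmxA LwN mulmx1.
have uLw l' : Lw l' \in unitmx by rewrite unitmxE det_lblock !det1 mulr1 unitr1.
have gA : good A 0.
  rewrite AE (_ : 0 = 0 *m Lw (- l) + 0); last by rewrite mul0mx addr0.
  by apply: good_comp; [apply: gpivot => //; rewrite unitmx_mul uA uLw|exact: good_lower].
(* The translation is supplied by a last factor [1%:M], which has a pivot. *)
rewrite -[A]mulmx1 -[v]add0r -[X in X + v](mul0mx _ 1%:M).
apply: good_comp => //; apply: gpivot; first exact: unitmx1.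
by rewrite mxE eqxx oner_neq0.
Qed.
End AffineVolume.

(** * Monotonicity, additivity and affine images *)

Section VolFacts.
Variable R : realType.
Notation lam := (@lebesgue_measure R).

(** The integral of a nonnegative function is a supremum over simple functions below it, which is
    monotone without any measurability. Hence [le_vol] applies to arbitrary sets, in particular to a
    polytope given only as a convex set. *)
Lemma ge0_le_integralS d (T : measurableType d) (mu : {measure set T -> \bar R})
    (f g : T -> \bar R) : (forall x, 0 <= f x)%E -> (forall x, f x <= g x)%E ->
  (\int[mu]_x f x <= \int[mu]_x g x)%E.
Proof.
move=> f0 fg.
have g0 x : (0 <= g x)%E by exact: le_trans (fg x).
rewrite !ge0_integralTE//.
apply: ge_ereal_sup => _ [h hf <-]; apply: ereal_sup_ubound.
by exists h => // x; exact: le_trans (fg x).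
Qed.

Lemma le_vol d (A B : set 'rV[R]_d) : A `<=` B -> (vol A <= vol B)%E.
Proof.
elim: d A B => [|d IH] A B AB /=.
  rewrite lee_fin !indicE ler_nat; case: (boolP (0 \in A)) => // /set_mem A0.
  by rewrite mem_set//; exact: AB.
apply: ge0_le_integralS => x; first exact: vol_ge0.
by apply: IH => y; exact: AB.
Qed.

Lemma vol_set0 d : vol (set0 : set 'rV[R]_d) = 0%E.
Proof. by have [m mE] := vol_measure R d; rewrite mE. Qed.

Lemma vol_setD d (E C : set (rowm R d)) : measurable E -> measurable C ->
  C `<=` E -> (vol E = vol (E `\` C) + vol C)%E.
Proof.
move=> mE mC CE; have [m mP] := vol_measure R d.
rewrite !mP//; last exact: measurableD.
by rewrite (measureDI m mE mC) (setIidr CE).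
Qed.

Lemma vol_bigcup_fin d (I : finType) (P : pred I) (C : I -> set (rowm R d)) :
  (forall i, measurable (C i)) -> trivIset [set i | P i] C ->
  vol (\bigcup_(i in [set i | P i]) C i) = (\sum_(i | P i) vol (C i))%E.
Proof.
move=> mC tC; have [m mP] := vol_measure R d.
rewrite mP; last by apply: fin_bigcup_measurable => //; exact: finite_finset.
rewrite measure_fin_bigcup//; last exact: finite_finset.
rewrite (_ : [set i | P i] = [set` enum P]); last first.
  by apply/seteqP; split => i /=; rewrite mem_enum.
rewrite -fsbig_seq ?enum_uniq// big_enum /=.
by apply: eq_bigr => i _; rewrite mP.
Qed.

Lemma vol_affine_image d (A : 'M[R]_d) (v : 'rV[R]_d) (E : set (rowm R d)) :
  A \in unitmx -> measurable E ->
  vol [set x *m A + v | x in E] = (`|\det A|%:E * vol E)%E.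
Proof.
move=> uA mE.
pose w := - (v *m invmx A).
have -> : [set x *m A + v | x in E] = [set y | E (y *m invmx A + w)].
  apply/seteqP; split => [_ [x Ex <-]|y /= Ey].
    by rewrite /= mulmxDl mulmxK// /w addrK.
  by exists (y *m invmx A + w) => //; rewrite mulmxDl mulmxKV// mulNmx mulmxKV// subrK.
have uA1 : invmx A \in unitmx by rewrite unitmx_inv.
rewrite (vol_affine w uA1 mE) det_inv muleA -EFinM -normrM.
by rewrite divrr ?normr1 ?mul1e// -unitmxE.
Qed.
End VolFacts.

(** * Regions between a separable graph and a horizontal roof *)

Section Bodies.
Variable R : realType.

Lemma measurable_set_ler d (T : measurableType d) (f g : T -> R) :
  measurable_fun setT f -> measurable_fun setT g ->
  measurable [set x | f x <= g x].
Proof.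
move=> mf mg; rewrite -[X in measurable X]setTI.
by rewrite -(preimage_true (fun x => f x <= g x)); exact: measurable_fun_ler.
Qed.

Lemma measurable_set_ltr d (T : measurableType d) (f g : T -> R) :
  measurable_fun setT f -> measurable_fun setT g ->
  measurable [set x | f x < g x].
Proof.
move=> mf mg; rewrite -[X in measurable X]setTI.
by rewrite -(preimage_true (fun x => f x < g x)); exact: measurable_fun_ltr.
Qed.
Notation lam := (@lebesgue_measure R).

Definition xcoord k (x : 'rV[R]_k.+1) (i : 'I_k) : R := x 0 (lift ord_max i).
Definition zcoord k (x : 'rV[R]_k.+1) : R := x 0 ord_max.

(** The flag [b] excludes the roof when true and includes it when false: caps are half-open, the
    uncut region is closed. The offset [e] collects the values of [h] at the coordinates already
    integrated out. *)
Definition body k (D : set R) (h : R -> R) (b : bool) (e s : R) : set 'rV[R]_k.+1 :=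
  [set x | (forall i, D (xcoord x i)) /\
    zcoord x \in Interval (BLeft (e + \sum_i h (xcoord x i))) (BSide b s)].

Lemma zcoord_cons k (t : R) (y : 'rV[R]_k.+1) : zcoord (cons_row (t, y)) = zcoord y.
Proof.
rewrite /zcoord (_ : ord_max = lift 0 ord_max) ?cons_rowS//; exact/val_inj.
Qed.

Lemma xcoord_cons0 k (t : R) (y : 'rV[R]_k.+1) : xcoord (cons_row (t, y)) 0 = t.
Proof.
rewrite /xcoord (_ : lift _ _ = 0) ?cons_row0//; exact/val_inj.
Qed.

Lemma xcoord_consS k (t : R) (y : 'rV[R]_k.+1) i :
  xcoord (cons_row (t, y)) (lift 0 i) = xcoord y i.
Proof.
rewrite /xcoord (_ : lift _ _ = lift 0 (lift ord_max i)) ?cons_rowS//.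
apply/val_inj; rewrite /= !/bump /=; have := ltn_ord i; lia.
Qed.

Lemma body_cons k D h b e s (t : R) :
  [set y | @body k.+1 D h b e s (cons_row (t, y))] =
  if t \in D then @body k D h b (e + h t) s else set0.
Proof.
case: (boolP (t \in D)) => [/set_mem Dt|Dt]; apply/seteqP; split => y //=.
- move=> [Dy]; rewrite zcoord_cons big_ord_recl xcoord_cons0 addrA.
  under eq_bigr do rewrite xcoord_consS.
  split=> // i; by have := Dy (lift 0 i); rewrite xcoord_consS.
- move=> [Dy zy]; split; last first.
    rewrite zcoord_cons big_ord_recl xcoord_cons0 addrA.
    by under eq_bigr do rewrite xcoord_consS.
  move=> i; case: (unliftP 0 i) => [j|] ->; first by rewrite xcoord_consS.
  by rewrite xcoord_cons0.
- move=> [Dy _]; move: Dt; rewrite notin_setE => /=; apply.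
  by have := Dy 0; rewrite xcoord_cons0.
Qed.

Lemma vol_body0 D h b e s : vol (@body 0 D h b e s) = (Num.max 0 (s - e))%:E.
Proof.
rewrite vol_cons.
transitivity (\int[lam]_x (\1_[set` Interval (BLeft e) (BSide b s)] x)%:E)%E.
  apply: eq_integral => x _ /=; rewrite !indicE; congr (_%:R%:E).
  congr (nat_of_bool _); apply/idP/idP => /set_mem /=; rewrite !inE /body /=.
    move=> [_]; rewrite big_ord0 addr0 (_ : zcoord _ = x)//.
    by rewrite -[RHS](@cons_row0 R 0 (x, 0)); congr (_ _ _); exact/val_inj.
  move=> xi; split; first by case.
  rewrite big_ord0 addr0 (_ : zcoord _ = x)//.
  by rewrite -[RHS](@cons_row0 R 0 (x, 0)); congr (_ _ _); exact/val_inj.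
rewrite integral_indic// setIT.
rewrite [LHS]lebesgue_measure_itv /= lte_fin.
case: ltP => es; rewrite -?EFinB; last by rewrite max_l// subr_le0.
by rewrite max_r// subr_ge0 ltW.
Qed.

Lemma vol_bodyS k D h b e s : vol (@body k.+1 D h b e s) =
  (\int[lam]_(t in D) vol (@body k D h b (e + h t) s))%E.
Proof.
rewrite vol_cons [RHS]integral_mkcond; apply: eq_integral => t _.
rewrite body_cons patchE; case: ifP => // _; exact: vol_set0.
Qed.

Lemma measurable_body k D h b e s : measurable D -> measurable_fun setT h ->
  measurable (@body k D h b e s : set (rowm R k.+1)).
Proof.
move=> mD mh.
have mx i : measurable_fun setT (fun x : rowm R k.+1 => h (xcoord x i)).
  apply: (measurableT_comp mh); exact: measurable_coord.
rewrite (_ : body _ _ _ _ _ = (\bigcap_(i in [set: 'I_k]) [set x | D (xcoord x i)]) `&`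
   ([set x | e + \sum_i h (xcoord x i) <= zcoord x] `&`
   [set x | zcoord x < s ?<= if ~~ b])); last first.
  apply/seteqP; split => x /=.
    move=> [Dx]; rewrite itv_boundlr => /andP[h1 h2].
    split; first by move=> i _; exact: Dx.
    by split; [exact: h1|move: h2; case: (b)].
  move=> [Dx [h1 h2]]; split => [i|]; first exact: Dx.
  by rewrite itv_boundlr; apply/andP; split; [exact: h1|move: h2; case: (b)].
have msum : measurable_fun setT (fun x : rowm R k.+1 => e + \sum_i h (xcoord x i)).
  apply: measurable_funD => //; exact: measurable_sum.
have mz : measurable_fun setT (fun x : rowm R k.+1 => zcoord x).
  exact: measurable_coord.
apply: measurableI.
  apply: fin_bigcap_measurable => // i _.
  rewrite -[X in measurable X]setTI; exact: measurable_coord.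
apply: measurableI.
  exact: measurable_set_ler.
case: (b) => /=; first exact: measurable_set_ltr.
exact: measurable_set_ler.
Qed.
End Bodies.

(** * Truncated powers and the two model volumes *)

Section Integrals.
Variable R : realType.
Notation lam := (@lebesgue_measure R).

Lemma continuous_affine_pow j (u v : R) : continuous (fun t : R => (u + v * t) ^+ j * v).
Proof.
move=> x; apply: cvgM; last exact: cvg_cst.
apply: (@continuous_comp _ _ _ (fun t => u + v * t) (fun y => y ^+ j)).
  apply: cvgD; first exact: cvg_cst.
  by apply: cvgM; first exact: cvg_cst.
exact: exprn_continuous.
Qed.

Lemma integral_affine_pow j (u v a b : R) : a < b ->
  (\int[lam]_(t in `[a, b]) ((u + v * t) ^+ j * v)%:E =
   ((u + v * b) ^+ j.+1 / j.+1%:R - (u + v * a) ^+ j.+1 / j.+1%:R)%:E)%E.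
Proof.
move=> ab.
pose F (t : R) := (u + v * t) ^+ j.+1 / j.+1%:R.
pose f (t : R) := (u + v * t) ^+ j * v.
have dF (x : R) : is_derive x 1 F (f x).
  have dl : is_derive x 1 (fun t : R => u + v * t) v.
    have -> : (fun t : R => u + v * t) = (cst u + v *: (@id R)) by apply/funext.
    by apply: is_derive_eq; rewrite add0r /GRing.scale /= mulr1.
  have -> : F = j.+1%:R^-1 *: ((fun t => u + v * t) ^+ j.+1).
    by apply/funext => t; rewrite /F /GRing.scale /= mulrC fctE.
  apply: is_derive_eq; rewrite /f /GRing.scale /=.
  by rewrite !mulrA mulVf ?mul1r// pnatr_eq0.
have dFf x : derivable F x 1 by have [] := dF x.
have cF : continuous F by move=> x; apply: differentiable_continuous; exact/derivable1_diffP.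
have cf : continuous f by exact: continuous_affine_pow.
rewrite (@continuous_FTC2 _ f F)//.
- exact: continuous_subspaceT.
- split.
  + by move=> x _.
  + by apply: cvg_at_right_filter; exact: cF.
  + by apply: cvg_at_left_filter; exact: cF.
- by move=> x _; rewrite derive1E; have [_] := dF x.
Qed.

(** The truncated power u_+^j / j!; integrating out one more coordinate raises [j] by one. For
    [j = 0] it is 1 even at negative [u], so the integration lemmas start at [j.+1]. *)
Definition ppow j (u : R) : R := Num.max 0 u ^+ j / j`!%:R.

Lemma ppow_ge0 j u : 0 <= ppow j u.
Proof. by rewrite divr_ge0// exprn_ge0// le_max lexx. Qed.

Lemma ppow_eq0 j u : u <= 0 -> ppow j.+1 u = 0.
Proof. by move=> u0; rewrite /ppow max_l// expr0n mul0r. Qed.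

Lemma continuous_ppow j : continuous (ppow j).
Proof.
move=> x; apply: cvgM; last exact: cvg_cst.
apply: (@continuous_comp _ _ _ (fun u : R => Num.max 0 u) (fun y => y ^+ j)).
  by apply: continuous_max; [exact: cst_continuous|move=> ?; exact: cvg_id].
exact: exprn_continuous.
Qed.

Lemma integral_ppow j u :
  (\int[lam]_(t in `[0%R, +oo[) (ppow j.+1 (u - t))%:E = (ppow j.+2 u)%:E)%E.
Proof.
have [u0|u0] := leP u 0.
  rewrite ppow_eq0// integral0_eq// => t /=; rewrite in_itv /= andbT => t0.
  by rewrite ppow_eq0//; lra.
transitivity (\int[lam]_(t in `[0%R, u]) ((- j.+1`!%:R^-1)%:E * ((u + -1 * t) ^+ j.+1 * -1)%:E))%E.
  rewrite integral_mkcond [RHS]integral_mkcond; apply: eq_integral => t _.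
  rewrite !patchE !mem_setE !in_itv /= andbT.
  have [t0|t0] /= := leP 0 t; last by [].
  have [tu|tu] := leP t u; last by rewrite ppow_eq0//; lra.
  rewrite -EFinM; congr EFin; rewrite /ppow max_r; last lra.
  by rewrite mulN1r mulrN1 mulrNN mulrC.
rewrite integralZl//; last first.
  apply: continuous_compact_integrable; first exact: segment_compact.
  apply: continuous_subspaceT; exact: continuous_affine_pow.
rewrite integral_affine_pow// -EFinM; congr EFin.
rewrite /ppow max_r ?ltW// mulN1r subrr expr0n mul0r sub0r mulr0 addr0 mulrNN.
by rewrite [in RHS]factS natrM invfM; ring.
Qed.

Lemma integral_ppow_norm j u :
  (\int[lam]_t (ppow j.+1 (u - `|t|))%:E = (2 * ppow j.+2 u)%:E)%E.
Proof.
rewrite (@ge0_symfun_integralT _ (fun t => ppow j.+1 (u - `|t|))).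
- rewrite EFinM -integral_ppow; congr (_ * _)%E.
  rewrite -set_itvcy; apply: eq_integral => t; rewrite inE /= in_itv /= andbT => t0.
  by rewrite ger0_norm.
- by move=> x; exact: ppow_ge0.
- move=> x; apply: (@continuous_comp _ _ _ (fun t : R => u - `|t|) (ppow j.+1)).
    by apply: cvgB; [exact: cvg_cst|exact: norm_continuous].
  exact: continuous_ppow.
- by move=> x; rewrite /= normrN.
Qed.

Lemma vol_body_simplex k b e s :
  vol (body (k:=k) `[0, +oo[ id b e s) = (ppow k.+1 (s - e))%:E.
Proof.
elim: k e => [|k IH] e.
  by rewrite vol_body0 /ppow expr1 (_ : 1`! = 1%N)// divr1.
rewrite vol_bodyS -integral_ppow; apply: eq_integral => t _.
by rewrite IH; congr (ppow _ _)%:E; ring.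
Qed.

Lemma vol_body_norm k b e s :
  vol (body (k:=k) setT (fun t : R => `|t|) b e s) = (2 ^+ k * ppow k.+1 (s - e))%:E.
Proof.
elim: k e => [|k IH] e.
  by rewrite vol_body0 /ppow expr1 (_ : 1`! = 1%N)// divr1 mul1r.
rewrite vol_bodyS exprSr -mulrA EFinM -integral_ppow_norm -ge0_integralZl//; last 2 first.
- apply/measurable_EFinP; apply: continuous_measurable_fun.
  move=> x; apply: (@continuous_comp _ _ _ (fun t : R => s - e - `|t|) (ppow k.+1)).
    by apply: cvgB; [exact: cvg_cst|exact: norm_continuous].
  exact: continuous_ppow.
- by move=> x _; rewrite lee_fin ppow_ge0.
apply: eq_integral => t _.
by rewrite IH -EFinM opprD addrA.
Qed.

End Integrals.

(** * The piecewise linear parabola *)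

Arguments vol : simpl never.

Section Parabola.
Variable R : realType.
Notation lam := (@lebesgue_measure R).
Implicit Types (n p : nat) (t : R).

(* On [0, n] this is the piecewise linear interpolation of the values p(p-1)/2
   at the integers p. *)
Definition qf n t : R := \sum_(1 <= j < n) Num.max 0 (t - j%:R).

Lemma qf_ge0 n t : 0 <= qf n t.
Proof. by apply: sumr_ge0 => j _; rewrite le_max lexx. Qed.

Lemma qf_mono n : {homo qf n : s t / s <= t}.
Proof.
move=> s t st; apply: ler_sum => j _.
by rewrite ge_max !le_max lexx /= lerD2r st orbT.
Qed.

Lemma qf_nat n p : (p <= n)%N -> qf n p%:R = 'C(p, 2)%:R.
Proof.
move=> pn; rewrite /qf.
transitivity ((\sum_(1 <= j < n) (p - j))%N%:R : R).
  rewrite natr_sum; apply: eq_bigr => j _.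
  case: (leqP j p) => jp; first by rewrite natrB// max_r// subr_ge0 ler_nat.
  rewrite max_l ?subr_le0 ?ler_nat 1?ltnW//.
  by rewrite (eqP (_ : (p - j == 0)%N)) // subn_eq0 ltnW.
congr _%:R.
case: p pn => [|p] pn; first by rewrite big1// => j _; rewrite sub0n.
rewrite (@big_cat_nat _ _ _ p.+1) //=.
have -> : (\sum_(p.+1 <= j < n) (p.+1 - j) = 0)%N.
  rewrite big_nat_cond big1// => j /andP[/andP[pj _] _].
  by apply/eqP; rewrite subn_eq0.
rewrite addn0.
rewrite big_nat_rev -bin2_sum [RHS]big_ltn// add0n.
rewrite big_nat_cond [RHS]big_nat_cond; apply: eq_bigr => j /andP[/andP[? ?] _]; lia.
Qed.

Lemma max0E t : Num.max 0 t = (t + `|t|) / 2.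
Proof. by case: (leP 0 t) => t0; [rewrite ger0_norm//|rewrite ltr0_norm//]; field. Qed.

Lemma qf_sub n p t : (0 < p < n)%N -> qf n t =
  \sum_(1 <= j < n | j != p) Num.max 0 (t - j%:R) + (t - p%:R + `|t - p%:R|) / 2.
Proof.
move=> /andP[p0 pn]; rewrite /qf (bigD1_seq p) ?iota_uniq//=; last first.
  by rewrite mem_index_iota p0 pn.
by rewrite addrC max0E.
Qed.

Lemma sum_lt (n p : nat) : (0 < p < n)%N ->
  \sum_(1 <= j < n | j != p) ((j < p)%N%:R : R) = p%:R - 1.
Proof.
move=> /andP[p0 pn]; rewrite -natr_sum big_mkcond /=.
rewrite (@big_cat_nat _ _ _ p) ?(ltnW pn)//=.
have -> : (\sum_(p <= j < n) (if j != p then (j < p)%N : nat else 0) = 0)%N.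
  rewrite big_nat_cond big1// => j /andP[/andP[pj _] _].
  by rewrite ltnNge pj /=; case: ifP.
rewrite addn0.
rewrite (eq_big_nat _ _ (F2 := fun=> 1%N)); last first.
  by move=> j /andP[_ jp]; rewrite jp ltn_eqF.
by rewrite sum_nat_const_nat muln1 natrB.
Qed.

(** The slope is p - 1 just before p and p just after it. The mean slope p - 1/2 supports the graph,
    and the kink leaves a margin of half the distance. At p = 0 the left side is 0 for nonnegative
    [t]. *)
Lemma qf_support n p t : (p < n)%N -> 0 <= t ->
  'C(p, 2)%:R + (p%:R - 2^-1) * (t - p%:R) + `|t - p%:R| / 2 <= qf n t.
Proof.
case: p => [|p] pn t0.
  by apply: le_trans (qf_ge0 n t); rewrite bin0n /= !subr0 sub0r add0r ger0_norm//; lra.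
rewrite -(@qf_nat n) 1?ltnW// !(@qf_sub n p.+1)// subrr normr0 addr0 mul0r addr0.
(* Away from the hinge at p itself, each hinge lies above its tangent at p; the tangent has slope 1
   for j < p and 0 otherwise. *)
have : \sum_(1 <= j < n | j != p.+1) (Num.max 0 (p.+1%:R - j%:R) + (j < p.+1)%N%:R * (t - p.+1%:R))
    <= \sum_(1 <= j < n | j != p.+1) Num.max 0 (t - j%:R).
  apply: ler_sum => j jp; case: (ltnP j p.+1) => jp'.
    rewrite mul1r max_r ?subr_ge0 ?ler_nat 1?ltnW//.
    by rewrite le_max; apply/orP; right; lra.
  by rewrite mul0r addr0 max_l ?le_max ?lexx// subr_le0 ler_nat.
rewrite big_split /= -mulr_suml sum_lt//; lra.
Qed.

Lemma qf_near n p t : (0 < p < n)%N -> `|t - p%:R| <= 1 ->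
  qf n t = 'C(p, 2)%:R + (p%:R - 2^-1) * (t - p%:R) + `|t - p%:R| / 2.
Proof.
move=> pn tp; have /andP[p0 pn'] := pn.
rewrite -(@qf_nat n) 1?ltnW// !(@qf_sub n p)// subrr normr0 addr0 mul0r addr0.
have : \sum_(1 <= j < n | j != p) Num.max 0 (t - j%:R) =
  \sum_(1 <= j < n | j != p) (Num.max 0 (p%:R - j%:R) + (j < p)%N%:R * (t - p%:R)).
  apply: eq_bigr => j jp; move: tp; rewrite ler_norml => /andP[h1 h2].
  case: (ltnP j p) => jp'.
    have : (j.+1%:R : R) <= p%:R by rewrite ler_nat.
    by rewrite -natr1 mul1r => h3; rewrite !max_r; lra.
  have : (p.+1%:R : R) <= j%:R by rewrite ler_nat ltn_neqAle eq_sym jp.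
  by rewrite -natr1 mul0r addr0 => h3; rewrite !max_l; lra.
rewrite big_split /= -mulr_suml sum_lt//; lra.
Qed.

Lemma qf_affine n (a : nat) (s : R) : 0 <= s <= 1 ->
  qf n (a%:R + s) = (1 - s) * qf n a%:R + s * qf n a.+1%:R.
Proof.
move=> /andP[s0 s1]; rewrite /qf !mulr_sumr -big_split /=; apply: eq_bigr => j _.
rewrite -natr1; case: (leqP j a) => ja.
  have : (j%:R : R) <= a%:R by rewrite ler_nat.
  by move=> h; rewrite !max_r; lra.
have : (a.+1%:R : R) <= j%:R by rewrite ler_nat.
by rewrite -natr1 => h; rewrite !max_l; lra.
Qed.

Lemma qf_convex n (s t a : R) : 0 <= a <= 1 ->
  qf n (a * s + (1 - a) * t) <= a * qf n s + (1 - a) * qf n t.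
Proof.
move=> /andP[a0 a1]; rewrite /qf !mulr_sumr -big_split /=; apply: ler_sum => j _.
rewrite ge_max; apply/andP; split.
  by rewrite addr_ge0// mulr_ge0 ?le_max ?lexx//; lra.
have -> : a * s + (1 - a) * t - j%:R = a * (s - j%:R) + (1 - a) * (t - j%:R) by ring.
by apply: lerD; apply: ler_wpM2l; rewrite ?le_max ?lexx ?orbT//; lra.
Qed.

Lemma continuous_hinge (c : R) : continuous (fun t : R => Num.max 0 (t - c)).
Proof.
move=> x; apply: (@continuous_max _ _ (cst 0) (fun t : R => t - c)); first exact: cst_continuous.
by move=> y; apply: cvgB; [exact: cvg_id|exact: cvg_cst].
Qed.

Lemma continuous_qf n : continuous (qf n).
Proof.
rewrite /qf; elim: (index_iota 1 n) => [|j r IH] x.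
  by under eq_fun do rewrite big_nil; exact: cvg_cst.
under eq_fun do rewrite big_cons.
apply: (@cvgD _ _ _ _ _ (fun t => Num.max 0 (t - j%:R))); last exact: IH.
exact: continuous_hinge.
Qed.

Lemma integral_qf n :
  (\int[lam]_(t in `[0%R, n%:R]) (qf n t)%:E =
   (\sum_(1 <= j < n) (n%:R - j%:R) ^+ 2 / 2)%:E)%E.
Proof.
rewrite /qf; under eq_integral do rewrite -sumEFin.
have mm (j : nat) : measurable_fun (`[0, n%:R] : set R) (fun t : R => (Num.max 0 (t - j%:R))%:E).
  apply/measurable_EFinP; apply: measurable_funTS; apply: continuous_measurable_fun.
  exact: continuous_hinge.
rewrite ge0_integral_sum//; last first.
  by move=> j t _; rewrite lee_fin le_max lexx.
rewrite -sumEFin big_nat_cond [in RHS]big_nat_cond; apply: eq_bigr => j /andP[/andP[j1 jn] _].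
transitivity (\int[lam]_(t in `[j%:R, n%:R]) (((- j%:R) + 1 * t) ^+ 1 * 1)%:E)%E.
  rewrite integral_mkcond [RHS]integral_mkcond; apply: eq_integral => t _.
  rewrite !patchE !mem_setE !in_itv /=.
  have [tn|tn] := leP t n%:R; last by rewrite !andbF.
  rewrite !andbT; have j0 : 0 <= j%:R :> R by [].
  have [jt|jt] := leP j%:R t.
    by rewrite (le_trans j0 jt) max_r ?subr_ge0// expr1 mul1r mulr1 addrC.
  by case: ifP => // _; rewrite max_l// subr_le0 ltW.
rewrite integral_affine_pow ?ltr_nat// !mul1r; congr EFin.
by rewrite addNr expr0n mul0r subr0 addrC.
Qed.

(** The condition places the roof above the highest value of the lower boundary, so nothing is
    truncated. For k = 0 the value of [k.-1] is immaterial because of the factor k. *)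
Lemma vol_body_qf n k (e s : R) : (0 < n)%N -> k%:R * qf n n%:R <= s - e ->
  vol (body (k := k) `[0, n%:R] (qf n) false e s) =
  (n%:R ^+ k * (s - e) - k%:R * n%:R ^+ k.-1 * \sum_(1 <= j < n) (n%:R - j%:R) ^+ 2 / 2)%:E.
Proof.
move=> n0; elim: k e => [|k IH] e kse.
  by rewrite vol_body0 max_r 1?(le_trans _ kse) ?mul0r// expr0 mul1r subr0.
rewrite vol_bodyS.
set Q := \sum_(1 <= j < n) _.
pose A : R := n%:R ^+ k * (s - e) - k%:R * n%:R ^+ k.-1 * Q.
transitivity (\int[lam]_(t in `[0%R, n%:R]) (A%:E - (n%:R ^+ k * qf n t)%:E))%E.
  apply: eq_integral => t; rewrite mem_setE in_itv /= => /andP[t0 tn].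
  rewrite IH -?EFinB; last first.
    have := qf_mono n tn; move: kse; rewrite -natr1; nra.
  by congr EFin; rewrite -/Q /A; ring.
have cq : continuous (fun t : R => n%:R ^+ k * qf n t).
  move=> x; apply: cvgM; [exact: cvg_cst|exact: continuous_qf].
rewrite integralB_EFin//; last 2 first.
- apply: continuous_compact_integrable; first exact: segment_compact.
  apply: continuous_subspaceT; exact: cst_continuous.
- apply: continuous_compact_integrable; first exact: segment_compact.
  exact: continuous_subspaceT.
rewrite integral_cst//= lebesgue_measure_itv/= lte_fin ltr0n n0 -EFinB subr0.
under [X in (_ - X)%E]eq_integral do rewrite EFinM.
rewrite ge0_integralZl//; last 2 first.
- apply: (@measurable_comp _ _ _ _ _ _ setT) => //; apply: measurable_funTS.
  by apply: continuous_measurable_fun; exact: continuous_qf.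
- by move=> t _; rewrite lee_fin qf_ge0.
rewrite integral_qf -/Q -!EFinM -EFinB; congr EFin; rewrite /A exprS.
case: (k) => [|k'] /=; first by rewrite expr0; ring.
by rewrite exprS -!natr1; ring.
Qed.

End Parabola.

(** * Affine maps that mix only into the last coordinate *)

Section Shear.
Variable R : realType.

Definition pt k (f : 'I_k -> R) (z : R) : 'rV[R]_k.+1 :=
  \row_j if unlift ord_max j is Some i then f i else z.

Lemma xcoord_pt k (f : 'I_k -> R) z i : xcoord (pt f z) i = f i.
Proof. by rewrite /xcoord /pt mxE liftK. Qed.

Lemma zcoord_pt k (f : 'I_k -> R) z : zcoord (pt f z) = z.
Proof. by rewrite /zcoord /pt mxE unlift_none. Qed.

Lemma row_xz k (x y : 'rV[R]_k.+1) :
  (forall i, xcoord x i = xcoord y i) -> zcoord x = zcoord y -> x = y.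
Proof.
move=> xy zz; apply/rowP => j; case: (unliftP ord_max j) => [i|] ->; first exact: xy.
exact: zz.
Qed.

Lemma big_lift_max (T : Type) (idx : T) (op : Monoid.law idx) k (F : 'I_k.+1 -> T) :
  \big[op/idx]_i F i = op (\big[op/idx]_(i < k) F (lift ord_max i)) (F ord_max).
Proof.
rewrite big_ord_recr; congr (op _ _); apply: eq_bigr => i _; congr F.
by apply/val_inj; rewrite /= /bump leqNgt ltn_ord.
Qed.

Definition shear k (a b c : 'I_k -> R) (g e : R) (x : 'rV[R]_k.+1) : 'rV[R]_k.+1 :=
  pt (fun i => a i * xcoord x i + b i) (g * zcoord x + \sum_i c i * xcoord x i + e).

Lemma vol_shear k (a b c : 'I_k -> R) (g e : R) (E : set (rowm R k.+1)) :
  (forall i, a i != 0) -> g != 0 -> measurable E ->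
  vol E = (`|(\prod_i a i) * g|%R%:E * vol [set x | E (shear a b c g e x)])%E.
Proof.
move=> a0 g0 mE.
pose A : 'M[R]_k.+1 := \matrix_(i, j)
  if unlift ord_max j is Some j' then (if i == j then a j' else 0)
  else (if unlift ord_max i is Some i' then c i' else g).
have dA : \det A = (\prod_i a i) * g.
  rewrite -det_tr det_trig.
    rewrite big_lift_max !mxE unlift_none; congr (_ * _).
    by apply: eq_bigr => i _; rewrite !mxE liftK eqxx.
  apply/is_trig_mxP => i j ij; rewrite !mxE.
  case: (unliftP ord_max i) => [i' ii'|iE]; first by rewrite ifN// neq_ltn ij orbT.
  by move: ij; rewrite iE ltnNge -ltnS ltn_ord.
have uA : A \in unitmx.
  rewrite unitmxE dA unitfE mulf_neq0//; apply/prodf_neq0 => i _; exact: a0.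
rewrite (vol_affine (pt b e) uA mE) dA; congr (_ * vol _)%E.
have xA (x : 'rV[R]_k.+1) : x *m A + pt b e = shear a b c g e x.
  apply: row_xz => [i|].
    rewrite xcoord_pt {1}/xcoord mxE -[pt b e _ _]/(xcoord _ _) xcoord_pt; congr (_ + _).
    rewrite mxE (bigD1 (lift ord_max i)) //= big1 => [|j ji].
      by rewrite mxE liftK eqxx addr0 mulrC.
    by rewrite mxE liftK (negbTE ji) mulr0.
  rewrite zcoord_pt {1}/zcoord mxE -[pt b e _ _]/(zcoord _) zcoord_pt; congr (_ + _).
  rewrite mxE big_lift_max mxE !unlift_none addrC mulrC; congr (_ + _).
  by apply: eq_bigr => j _; rewrite mxE unlift_none liftK mulrC.
by apply/seteqP; split => x /=; rewrite xA.
Qed.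
End Shear.

(** * Convex hulls and cuts *)

Section Convexity.
Variables (R : realType) (d : nat).
Implicit Types (X Y C K : set 'rV[R]_d) (x y : 'rV[R]_d) (t : R).

Lemma convexP C : @convex_set R 'rV[R]_d C <->
  forall x y t, C x -> C y -> 0 <= t <= 1 -> C (t *: x + (1 - t) *: y).
Proof.
split=> [cC x y t Cx Cy /andP[t0 t1]|cC x y l /set_mem Cx /set_mem Cy].
  pose l : {i01 R} := Itv01 t0 t1.
  by have := cC x y l (mem_set Cx) (mem_set Cy); rewrite inE.
rewrite inE; apply: cC => //.
by rewrite ge0 le1.
Qed.

Lemma conv_hull_convex X : @convex_set R 'rV[R]_d (conv_hull X).
Proof.
apply/convexP => x y t Xx Xy t01 C [cC XC].
by move/convexP: (cC) => /(_ x y t); apply => //; [exact: Xx|exact: Xy].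
Qed.

Lemma conv_hull_sub X : X `<=` conv_hull X.
Proof. exact: sub_gen_smallest. Qed.

Lemma conv_hull_min X C : @convex_set R 'rV[R]_d C -> X `<=` C -> conv_hull X `<=` C.
Proof. by move=> cC XC; exact: smallest_sub. Qed.

Lemma conv_hull_mono X Y : X `<=` Y -> conv_hull X `<=` conv_hull Y.
Proof.
move=> XY; apply: conv_hull_min; first exact: conv_hull_convex.
exact: subset_trans XY (@conv_hull_sub Y).
Qed.

Lemma convex_sum (I : finType) C (w : I -> R) (p : I -> 'rV[R]_d) :
  @convex_set R 'rV[R]_d C -> (forall i, 0 <= w i) -> \sum_i w i = 1 ->
  (forall i, C (p i)) -> C (\sum_i w i *: p i).
Proof.
move=> cC w0 w1 Cp.
(* Partial sums are rescaled to total weight 1, so that the induction stays among convex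
   combinations. *)
suff H (r : seq I) : 0 < \sum_(i <- r) w i ->
    C ((\sum_(i <- r) w i)^-1 *: \sum_(i <- r) w i *: p i).
  by have := H (index_enum I); rewrite w1 invr1 scale1r; apply.
elim: r => [|i r IH]; first by rewrite big_nil ltxx.
rewrite !big_cons; set s := \sum_(j <- r) w j; set v := \sum_(j <- r) _ => sp.
have s0 : 0 <= s by apply: sumr_ge0.
have [s_0|s_n0] := eqVneq s 0.
  have -> : v = 0.
    rewrite /v; apply/eqP; move: s_0 => /eqP.
    rewrite /s psumr_eq0// => /allP ar; rewrite big_seq big1// => j jr.
    by have /eqP -> := ar j jr; rewrite scale0r.
  move: sp; rewrite s_0 !addr0 => wi.
  by rewrite scalerA mulVf ?gt_eqF// scale1r.
have {}s0 : 0 < s by rewrite lt_neqAle eq_sym s_n0.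
have := IH s0; rewrite -/s -/v => Cv.
have -> : (w i + s)^-1 *: (w i *: p i + v) =
    (w i / (w i + s)) *: p i + (1 - w i / (w i + s)) *: (s^-1 *: v).
  rewrite scalerDr !scalerA mulrC; congr (_ + _ *: _).
  by field; rewrite s_n0 gt_eqF.
have /convexP := cC; apply => //.
apply/andP; split; first by rewrite divr_ge0// ltW.
by rewrite ler_pdivrMr// mul1r lerDl ltW.
Qed.

Definition is_affine (l : 'rV[R]_d -> R) :=
  forall x y t, l (t *: x + (1 - t) *: y) = t * l x + (1 - t) * l y.

Definition lattice_pts : set 'rV[R]_d := [set x | x \is a mxOver Num.int].

(* Points where [l] is negative may be replaced by the crossing points with the
   hyperplane [l = 0]. *)
Lemma lattice_hull_cut K (l : 'rV[R]_d -> R) : is_affine l ->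
  @convex_set R 'rV[R]_d K -> K `<=` conv_hull (K `&` lattice_pts) ->
  (forall x, K x -> l x = 0 ->
    conv_hull (K `&` [set x | 0 <= l x] `&` lattice_pts) x) ->
  K `&` [set x | 0 <= l x] `<=` conv_hull (K `&` [set x | 0 <= l x] `&` lattice_pts).
Proof.
move=> al cK KL Kl x [Kx lx].
set C := conv_hull _.
have cC : @convex_set R 'rV[R]_d C by exact: conv_hull_convex.
pose D := [set x | K x /\ (0 <= l x -> C x)].
suff : D x by case=> _; apply.
have cross y z t : K y -> K z -> C y -> 0 <= l y -> l z < 0 -> 0 <= t <= 1 ->
    0 <= l (t *: y + (1 - t) *: z) -> C (t *: y + (1 - t) *: z).
  move=> Ky Kz Cy ly lz /andP[t0 t1] lt.
  pose s := - l z / (l y - l z).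
  have lyz : 0 < l y - l z by rewrite subr_gt0 (lt_le_trans lz).
  have sE : s * (l y - l z) = - l z by rewrite /s divfK// gt_eqF.
  have s0 : 0 < s by rewrite divr_gt0// oppr_gt0.
  have s1 : s <= 1 by rewrite ler_pdivrMr// mul1r; lra.
  have st : s <= t.
    by move: lt; rewrite al => lt; rewrite -(ler_pM2r lyz) sE; lra.
  have [s_1|s_n1] := eqVneq s 1.
    have -> : t = 1 by lra.
    by rewrite subrr scale0r addr0 scale1r.
  have {}s1 : s < 1 by rewrite lt_neqAle s_n1.
  have -> : t *: y + (1 - t) *: z = ((t - s) / (1 - s)) *: y +
      (1 - (t - s) / (1 - s)) *: (s *: y + (1 - s) *: z).
    rewrite scalerDr addrA !scalerA -scalerDl; congr (_ *: _ + _ *: _); field; lra.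
  apply: (convexP C).1 => //.
    apply: Kl; first by apply: (convexP K).1 => //; rewrite !ltW.
    by rewrite al; lra.
  apply/andP; split; first by rewrite divr_ge0// subr_ge0// ltW.
  by rewrite ler_pdivrMr ?subr_gt0// mul1r lerD2r.
apply: (@conv_hull_min (K `&` lattice_pts) D); last exact: KL.
  apply/convexP => y z t [Ky Cy] [Kz Cz] t01; split.
    by apply: (convexP K).1.
  case: (leP 0 (l y)) => ly; case: (leP 0 (l z)) => lz lt.
  - by apply: (convexP C).1; [|exact: Cy|exact: Cz|].
  - by apply: cross => //; exact: Cy.
  - have tE : t = 1 - (1 - t) by ring.
    rewrite addrC {2}tE; apply: cross => //; first exact: Cz.
      by move: t01; lra.
    by rewrite -tE addrC.
  - move: lt; rewrite al; case/andP: t01 => t0 t1.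
    have [t_0|t_n0] := eqVneq t 0; first by rewrite t_0; lra.
    have : 0 < t by rewrite lt_neqAle eq_sym t_n0.
    by move=> tp; nra.
by move=> y [Ky Ly]; split => // ly; apply: conv_hull_sub.
Qed.

Definition cut_set (I : finType) (act : pred I) (l : I -> 'rV[R]_d -> R) K : set 'rV[R]_d :=
  [set x | K x /\ forall i, act i -> 0 <= l i x].

Lemma cut_set_convex (I : finType) (act : pred I) (l : I -> 'rV[R]_d -> R) K :
  (forall i, is_affine (l i)) -> @convex_set R 'rV[R]_d K ->
  @convex_set R 'rV[R]_d (cut_set act l K).
Proof.
move=> al /convexP cK; apply/convexP => x y t [Kx lx] [Ky ly] t01.
split=> [|i ai]; first exact: cK.
by case/andP: t01 => t0 t1; rewrite al addr_ge0// mulr_ge0 ?subr_ge0 ?lx ?ly.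
Qed.

(** The cuts are made one at a time. Crossing points are assumed to lie in the hull of the lattice
    points surviving all cuts; these also survive at every intermediate stage, where
    [lattice_hull_cut] applies. *)
Lemma cut_set_lattice_hull (I : finType) (act : pred I) (l : I -> 'rV[R]_d -> R) K :
  (forall i, is_affine (l i)) -> @convex_set R 'rV[R]_d K ->
  K `<=` conv_hull (K `&` lattice_pts) ->
  (forall i x, act i -> K x -> l i x = 0 -> conv_hull (cut_set act l K `&` lattice_pts) x) ->
  cut_set act l K `<=` conv_hull (cut_set act l K `&` lattice_pts).
Proof.
move=> al cK KL Kl.
pose Ks (s : seq I) := cut_set [pred i | (i \in s) && act i] l K.
suff H s : Ks s `<=` conv_hull (Ks s `&` lattice_pts).
  suff <- : Ks (enum I) = cut_set act l K by exact: H.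
  by apply/seteqP; split => x [Kx lx]; split => // i ai; apply: lx;
    rewrite /= mem_enum in ai *.
elim: s => [|i s IH].
  suff -> : Ks [::] = K by [].
  by apply/seteqP; split => [x []//|x Kx]; split.
have KsE : Ks (i :: s) = if act i then Ks s `&` [set x | 0 <= l i x] else Ks s.
  case: ifP => ai; apply/seteqP; split => x.
  - move=> [Kx lx]; split; last by apply: lx; rewrite /= inE eqxx.
    by split => // j /andP[js aj]; apply: lx; rewrite /= inE js orbT.
  - move=> [[Kx lx] lix]; split => // j /andP[]; rewrite inE => /orP[/eqP -> //|js] aj.
    by apply: lx; rewrite /= js.
  - move=> [Kx lx]; split => // j /andP[js aj]; apply: lx.
    by rewrite /= inE js orbT.
  - move=> [Kx lx]; split => // j /andP[]; rewrite inE => /orP[/eqP -> |js] aj.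
      by rewrite ai in aj.
    by apply: lx; rewrite /= js.
rewrite KsE; case: ifP => // ai.
apply: lattice_hull_cut => //; first exact: cut_set_convex.
move=> x [Kx _] lx; apply: conv_hull_mono (Kl _ _ ai Kx lx).
move=> y [[Ky ly] Ly]; split => //; split; last exact: ly.
by split => // j /andP[_ aj]; exact: ly.
Qed.

Lemma conv_hull_image (A : 'M[R]_d) (v : 'rV[R]_d) X :
  conv_hull [set x *m A + v | x in X] = [set x *m A + v | x in conv_hull X].
Proof.
have comb x y t : (t *: x + (1 - t) *: y) *m A + v =
    t *: (x *m A + v) + (1 - t) *: (y *m A + v).
  rewrite mulmxDl -!scalemxAl !scalerDr addrACA -scalerDl addrCA subrr addr0 scale1r.
  by [].
apply/seteqP; split.
  apply: conv_hull_min.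
    apply/convexP => _ _ t [x Xx <-] [y Xy <-] t01.
    exists (t *: x + (1 - t) *: y) => //.
    by apply: (convexP _).1 => //; exact: conv_hull_convex.
  by move=> _ [x Xx <-]; exists x => //; exact: conv_hull_sub.
move=> _ [x Xx <-].
pose D := [set x | conv_hull [set x *m A + v | x in X] (x *m A + v)].
suff : conv_hull X `<=` D by apply.
apply: conv_hull_min.
  apply/convexP => y z t Dy Dz t01; rewrite /D /= comb.
  by apply: (convexP _).1 => //; exact: conv_hull_convex.
by move=> y Xy; apply: conv_hull_sub; exists y.
Qed.

(** If the image of [p] were missing from [X], then [X], and with it the hull, would lie in the open
    half-space where the transported [l] is positive; but [l] vanishes at [p]. With [X] consisting
    of lattice points, exposed vertices go to lattice points. *)
Lemma exposed_image (P X : set 'rV[R]_d) (l : 'rV[R]_d -> R) (p v : 'rV[R]_d) (A : 'M[R]_d) :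
  is_affine l -> P p -> l p = 0 -> (forall x, P x -> 0 <= l x) ->
  (forall x, P x -> l x = 0 -> x = p) -> A \in unitmx ->
  [set x *m A + v | x in P] = conv_hull X -> X (p *m A + v).
Proof.
move=> al Pp lp Pl Pu uA PX.
apply: contrapT => nX.
pose D := [set y | 0 < l ((y - v) *m invmx A)].
have : conv_hull X `<=` D.
  apply: conv_hull_min.
    apply/convexP => y z t Dy Dz /andP[t0 t1]; rewrite /D /=.
    rewrite (_ : (_ - v) *m invmx A =
      t *: ((y - v) *m invmx A) + (1 - t) *: ((z - v) *m invmx A)).
      rewrite al; have [->|t_n0] := eqVneq t 0; first by rewrite mul0r add0r subr0 mul1r.
      by apply: ltr_wpDr; [rewrite mulr_ge0 ?subr_ge0// ltW|
        rewrite mulr_gt0// lt_neqAle eq_sym t_n0].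
    rewrite !scalemxAl -mulmxDl; congr (_ *m _).
    by rewrite !scalerBr addrACA -opprD -scalerDl [t + _]addrC subrK scale1r.
  move=> y Xy; have : conv_hull X y by exact: conv_hull_sub.
  rewrite -PX => -[x Px xy]; rewrite /D /= -xy addrK mulmxK//.
  rewrite lt_neqAle Pl// andbT eq_sym; apply/eqP => lx.
  by apply: nX; rewrite -(Pu _ Px lx) xy.
rewrite -PX => /(_ (p *m A + v)) /= H.
have : 0 < l ((p *m A + v - v) *m invmx A) by apply: H; exists p.
by rewrite addrK mulmxK// lp ltxx.
Qed.

End Convexity.

(** * The family of polytopes *)

Section AffineForms.
Variables (R : realType) (d : nat).
Implicit Types (l : 'rV[R]_d -> R).

Lemma affine_cst (c : R) : is_affine (fun _ : 'rV[R]_d => c).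
Proof. by move=> x y t; ring. Qed.

Lemma affineD l1 l2 : is_affine l1 -> is_affine l2 -> is_affine (fun x => l1 x + l2 x).
Proof. by move=> a1 a2 x y t; rewrite a1 a2; ring. Qed.

Lemma affineZ (c : R) l : is_affine l -> is_affine (fun x => c * l x).
Proof. by move=> al x y t; rewrite al; ring. Qed.

Lemma affine_sum (I : finType) (l : I -> 'rV[R]_d -> R) :
  (forall i, is_affine (l i)) -> is_affine (fun x => \sum_i l i x).
Proof.
move=> al x y t; rewrite !mulr_sumr -big_split /=.
by apply: eq_bigr => i _; exact: al.
Qed.

Lemma affine_coord (i : 'I_d) : is_affine (fun x : 'rV[R]_d => x 0 i).
Proof. by move=> x y t; rewrite !mxE. Qed.
End AffineForms.

Section Construction.
Variables (R : realType) (k M H : nat).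

Let L := M.+1.
Let n := L.*2.
Definition site := {ffun 'I_k -> 'I_M}.
(* Odd coordinates, so that no two sites are neighbours, and at least 3, so that no
   site meets the unimodular frame, whose coordinates are at most 2. *)
Definition sitec (u : site) (i : 'I_k) : nat := ((u i).*2 + 3)%N.

(** With M = L - 1 values on each axis the largest site coordinate is 2M + 1 = n - 1, so both
    neighbours of a site along any axis remain in the box. *)
Lemma sitec_bounds u i : (0 < sitec u i < n)%N.
Proof. rewrite /sitec /n /L; have := ltn_ord (u i); lia. Qed.

Definition height (x : 'rV[R]_k.+1) : R := \sum_i qf n (xcoord x i).

Definition bowl : set 'rV[R]_k.+1 := body `[0, n%:R] (qf n) false 0 H%:R.

Lemma bowlP x : bowl x <->
  (forall i, 0 <= xcoord x i <= n%:R) /\ (height x <= zcoord x <= H%:R).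
Proof.
rewrite /bowl /body /= itv_boundlr add0r; split => -[h1 h2]; split => //.
Qed.

Lemma xcoord_conv (x y : 'rV[R]_k.+1) t i :
  xcoord (t *: x + (1 - t) *: y) i = t * xcoord x i + (1 - t) * xcoord y i.
Proof. exact: affine_coord. Qed.

Lemma zcoord_conv (x y : 'rV[R]_k.+1) t :
  zcoord (t *: x + (1 - t) *: y) = t * zcoord x + (1 - t) * zcoord y.
Proof. exact: affine_coord. Qed.

Lemma bowl_convex : @convex_set R 'rV[R]_k.+1 bowl.
Proof.
apply/convexP => x y t /bowlP[Bx /andP[fx zx]] /bowlP[By /andP[fy zy]] t01.
have /andP[t0 t1] := t01.
apply/bowlP; split=> [i|].
  rewrite xcoord_conv; have /andP[? ?] := Bx i; have /andP[? ?] := By i.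
  by apply/andP; split; nra.
rewrite zcoord_conv; apply/andP; split; last nra.
apply: (@le_trans _ _ (t * height x + (1 - t) * height y)); last nra.
rewrite /height !mulr_sumr -big_split /=; apply: ler_sum => i _.
by rewrite xcoord_conv; exact: qf_convex.
Qed.

Lemma qf_max : qf n n%:R = 'C(n, 2)%:R :> R.
Proof. exact: qf_nat. Qed.

Lemma height_le x : (forall i, 0 <= xcoord x i <= n%:R) -> height x <= (k * 'C(n, 2))%:R.
Proof.
move=> Bx; rewrite natrM -[X in X%:R * _](card_ord k) -sum1_card natr_sum mulr_suml.
apply: ler_sum => i _; rewrite mul1r -qf_max; apply: qf_mono.
by have /andP[] := Bx i.
Qed.

Lemma pt_lattice (y : 'I_k -> nat) (z : nat) : lattice_pts (pt (fun i => (y i)%:R) z%:R : 'rV[R]_k.+1).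
Proof.
apply/mxOverP => i j; rewrite mxE; case: unliftP => [j' _|_]; exact: natr_int.
Qed.

(** The lower boundary rises to at most k times C(n, 2). Above it, one unit is reserved for the site
    caps and L for the corner caps below the roof, so that the two kinds never meet. *)
Hypothesis H_ge : (k * 'C(n, 2) + L + 1 <= H)%N.

Lemma H_geR : (k * 'C(n, 2))%:R + L%:R + 1 <= H%:R :> R.
Proof. by rewrite -[X in _ + X]/(1%:R) -!natrD ler_nat. Qed.

Lemma nE : n%:R = 2 * L%:R :> R.
Proof. by rewrite /n -mul2n natrM. Qed.

Lemma L_ge1 : 1 <= L%:R :> R.
Proof. by rewrite ler1n. Qed.

Definition upd (f : 'I_k -> R) (j : 'I_k) (a : R) (i : 'I_k) : R :=
  if i == j then a else f i.

(* A function that is affine along every unit segment parallel to an axis takes,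
   at any point of the box, a value interpolated from the lattice_pts points. *)
Lemma grid_hull (C : set 'rV[R]_k.+1) (G : ('I_k -> R) -> R) :
  @convex_set R 'rV[R]_k.+1 C ->
  (forall f g, f =1 g -> G f = G g) ->
  (forall f j (a : nat) s, 0 <= s <= 1 -> f j = a%:R + s ->
    G f = (1 - s) * G (upd f j a%:R) + s * G (upd f j a.+1%:R)) ->
  (forall y : 'I_k -> nat, (forall i, (y i <= n)%N) ->
    C (pt (fun i => (y i)%:R) (G (fun i => (y i)%:R)))) ->
  forall f, (forall i, 0 <= f i <= n%:R) -> C (pt f (G f)).
Proof.
move=> cC extG Gaff GC f Bf.
(* Induction on [m]: only the coordinates of index below [m] may be non-integral, and the last of
   these is split between its two integer neighbours. *)
suff H' m : forall f, (forall i, 0 <= f i <= n%:R) ->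
    (forall i : 'I_k, (m <= i)%N -> exists a : nat, f i = a%:R) -> C (pt f (G f)).
  by apply: (H' k) => // i; rewrite leqNgt ltn_ord.
elim: m => [|m IH] {Bf}f Bf fm.
  have /choice[y yE] : forall i, exists a : nat, f i = a%:R by move=> i; exact: fm.
  have fy : f = (fun i => (y i)%:R) by apply/funext.
  rewrite fy; apply: GC => i.
  by have /andP[_] := Bf i; rewrite yE ler_nat.
have [mk|km] := ltnP m k; last first.
  apply: IH => // i mi; have := ltn_ord i; rewrite ltnNge.
  by rewrite (leq_trans km mi).
pose j := Ordinal mk; have /andP[fj0 fjn] := Bf j.
pose a := Num.truncn (f j).
have /andP[af fa] : a%:R <= f j < a.+1%:R by exact: truncn_itv.
have [fja|fja] := eqVneq (f j) a%:R.
  apply: IH => // i; rewrite leq_eqVlt => /orP[/eqP mi|]; last exact: fm.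
  by exists a; rewrite -fja; congr f; exact/val_inj.
have an : (a < n)%N.
  by rewrite -(ltr_nat R); apply: lt_le_trans fjn; rewrite lt_neqAle eq_sym fja.
pose s := f j - a%:R.
have s01 : 0 <= s <= 1 by rewrite /s; move: fa; rewrite -natr1; lra.
have Bu (c : nat) : (c <= n)%N -> forall i, 0 <= upd f j c%:R i <= n%:R.
  by move=> cn i; rewrite /upd; case: ifP => // _; rewrite ler0n ler_nat.
have Cu (c : nat) : (c <= n)%N -> C (pt (upd f j c%:R) (G (upd f j c%:R))).
  move=> cn; apply: IH; first exact: Bu.
  move=> i; rewrite leq_eqVlt => /orP[/eqP mi|mi].
    by exists c; rewrite /upd ifT//; apply/eqP/val_inj.
  by rewrite /upd; case: ifP => [_|_]; [exists c|exact: fm].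
have -> : pt f (G f) = (1 - s) *: pt (upd f j a%:R) (G (upd f j a%:R)) +
    (1 - (1 - s)) *: pt (upd f j a.+1%:R) (G (upd f j a.+1%:R)).
  apply: row_xz => [i|].
    rewrite xcoord_conv !xcoord_pt /upd; case: eqP => [->|_]; last by ring.
    by rewrite -natr1 /s; ring.
  rewrite zcoord_conv !zcoord_pt subKr; apply: Gaff => //.
  by rewrite /s addrC subrK.
apply: (convexP C).1 => //; [exact/Cu/ltnW|exact: Cu|by move: s01; lra].
Qed.

Lemma height_pt_nat (y : 'I_k -> nat) z : (forall i, (y i <= n)%N) ->
  height (pt (fun i => (y i)%:R) z) = (\sum_i 'C(y i, 2))%:R.
Proof.
move=> yn; rewrite /height natr_sum; apply: eq_bigr => i _.
by rewrite xcoord_pt qf_nat.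
Qed.

(** Each point lies on a vertical segment from the lower boundary to the roof, and [grid_hull]
    handles both endpoints: the height is affine along unit axis segments, the roof is constant. *)
Lemma bowl_lattice : bowl `<=` conv_hull (bowl `&` lattice_pts (d := k.+1)).
Proof.
set C := conv_hull _ => x Kx; have /bowlP[Bx /andP[fx zx]] := Kx.
have cC : @convex_set R 'rV[R]_k.+1 C by exact: conv_hull_convex.
have hb := height_le Bx; have hH := H_geR; have L1 := L_ge1.
have bot : C (pt (xcoord x) (height x)).
  pose G (f : 'I_k -> R) := \sum_i qf n (f i).
  apply: (@grid_hull C G) => //.
  - by move=> f g fg; apply: eq_bigr => i _; rewrite fg.
  - move=> f j a s s01 fj.
    have GE g : G g = qf n (g j) + \sum_(i | i != j) qf n (g i) by rewrite /G (bigD1 j).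
    have restE c : \sum_(i | i != j) qf n (upd f j c i) = \sum_(i | i != j) qf n (f i).
      by apply: eq_bigr => i /negbTE ij; rewrite /upd ij.
    by rewrite !GE !restE /upd eqxx fj qf_affine//; ring.
  - move=> y yn; apply: conv_hull_sub; split; last first.
      rewrite (_ : G _ = (\sum_i 'C(y i, 2))%:R); first exact: pt_lattice.
      by rewrite natr_sum; apply: eq_bigr => i _; rewrite qf_nat.
    have By i : 0 <= xcoord (pt (fun i => (y i)%:R) (G (fun i => (y i)%:R))) i <= n%:R.
      by rewrite xcoord_pt ler0n ler_nat yn.
    apply/bowlP; split => //; have := height_le By; rewrite zcoord_pt.
    rewrite (_ : height _ = G (fun i => (y i)%:R)) ?lexx /=; first by lra.
    by apply: eq_bigr => i _; rewrite xcoord_pt.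
have top : C (pt (xcoord x) H%:R).
  apply: (@grid_hull C (fun=> H%:R)) => //.
  - by move=> f j a s s01 fj; ring.
  - move=> y yn; apply: conv_hull_sub; split; last exact: pt_lattice.
    have By i : 0 <= xcoord (pt (fun i => (y i)%:R) (H%:R : R)) i <= n%:R.
      by rewrite xcoord_pt ler0n ler_nat yn.
    apply/bowlP; split => //; have := height_le By; rewrite zcoord_pt; lra.
have hlt : height x < H%:R by lra.
pose t := (H%:R - zcoord x) / (H%:R - height x).
have -> : x = t *: pt (xcoord x) (height x) + (1 - t) *: pt (xcoord x) H%:R.
  apply: row_xz => [i|].
    by rewrite xcoord_conv !xcoord_pt; ring.
  by rewrite zcoord_conv !zcoord_pt /t; field; lra.
apply: (convexP C).1 => //; apply/andP; split.
  by rewrite divr_ge0 ?subr_ge0// ltW.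
by rewrite ler_pdivrMr ?subr_gt0// mul1r; lra.
Qed.

End Construction.

Lemma affineN (R : realType) d (l : 'rV[R]_d -> R) :
  is_affine l -> is_affine (fun x => - l x).
Proof. by move=> al x y t; rewrite al; ring. Qed.

(** The index j < k stands for the top corner with x_j = n and the other horizontal coordinates 0;
    [ord_max] stands for the one over the origin. Two different corners therefore sit at opposite
    ends of some axis. *)
Lemma corner_diff k (j j' : 'I_k.+1) : j != j' ->
  exists i, (lift ord_max i == j) != (lift ord_max i == j').
Proof.
move=> jj.
case: (unliftP ord_max j) jj => [i -> jj|jE].
  by exists i; rewrite eqxx (negbTE jj).
case: (unliftP ord_max j') => [i -> _|-> /eqP//].
have := neq_lift ord_max i; rewrite eq_sym => /negbTE li.
by exists i; rewrite eqxx jE li.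
Qed.

(** * Cutting off sites and top corners *)

Section Cuts.
Variables (R : realType) (k M H : nat).
Let L := M.+1.
Let n := L.*2.
Notation bowl := (@bowl R k M H).
Notation site := (site k M).
Hypothesis H_ge : (k * 'C(n, 2) + L + 1 <= H)%N.
Implicit Types (u : site) (x : 'rV[R]_k.+1) (b : 'I_k.+1 -> nat) (j : 'I_k.+1).

Lemma binR (p : nat) : 'C(p, 2)%:R = p%:R * (p%:R - 1) / 2 :> R.
Proof.
elim: p => [|p IH]; first by rewrite bin0n mul0r mul0r.
by rewrite binS bin1 natrD IH -natr1; field.
Qed.

(* [lsite u] vanishes on the hyperplane through the lifts of the neighbours of the
   site [u], and equals -1 at the lift of [u] itself. *)
Definition lsite u x : R :=
  2 * (zcoord x - (\sum_i 'C(sitec u i, 2))%:R)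
  - \sum_i (2 * (sitec u i)%:R - 1) * (xcoord x i - (sitec u i)%:R) - 1.

Definition norm1 u x : R := \sum_i `|xcoord x i - (sitec u i)%:R|.

(** The margins in [qf_support] add up to half the l1 distance from the site; the factor 2 in
    [lsite] clears the half. *)
Lemma lsite_ge u x : (forall i, 0 <= xcoord x i) ->
  norm1 u x - 1 + 2 * (zcoord x - height M x) <= lsite u x.
Proof.
move=> x0; rewrite /lsite /norm1 /height.
suff : (\sum_i 'C(sitec u i, 2))%:R + \sum_i ((sitec u i)%:R - 2^-1) * (xcoord x i - (sitec u i)%:R)
    + (\sum_i `|xcoord x i - (sitec u i)%:R|) / 2 <= \sum_i qf n (xcoord x i).
  have -> : \sum_i (2 * (sitec u i)%:R - 1) * (xcoord x i - (sitec u i)%:R) =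
     2 * \sum_i ((sitec u i)%:R - 2^-1) * (xcoord x i - (sitec u i)%:R).
    by rewrite mulr_sumr; apply: eq_bigr => i _; field.
  by rewrite -/n; lra.
rewrite natr_sum mulr_suml -!big_split /=; apply: ler_sum => i _.
by have /andP[_ h] := sitec_bounds u i; apply: qf_support.
Qed.

Lemma lsite_near u x : (forall i, `|xcoord x i - (sitec u i)%:R| <= 1) ->
  lsite u x = norm1 u x - 1 + 2 * (zcoord x - height M x).
Proof.
move=> x1; rewrite /lsite /norm1 /height.
have -> : \sum_i qf n (xcoord x i) = (\sum_i 'C(sitec u i, 2))%:R +
    \sum_i ((sitec u i)%:R - 2^-1) * (xcoord x i - (sitec u i)%:R)
    + (\sum_i `|xcoord x i - (sitec u i)%:R|) / 2.
  rewrite natr_sum mulr_suml -!big_split /=; apply: eq_bigr => i _.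
  by apply: qf_near => //; exact: sitec_bounds.
have -> : \sum_i (2 * (sitec u i)%:R - 1) * (xcoord x i - (sitec u i)%:R) =
   2 * \sum_i ((sitec u i)%:R - 2^-1) * (xcoord x i - (sitec u i)%:R).
  by rewrite mulr_sumr; apply: eq_bigr => i _; field.
by field.
Qed.

Definition lift_pt (y : 'I_k -> nat) : 'rV[R]_k.+1 :=
  pt (fun i => (y i)%:R) (\sum_i 'C(y i, 2))%:R.

Lemma lsite_lift_pt u y :
  lsite u (lift_pt y) = \sum_i ((y i)%:R - (sitec u i)%:R) ^+ 2 - 1.
Proof.
rewrite /lsite /lift_pt zcoord_pt; congr (_ - 1).
rewrite !natr_sum -sumrB mulr_sumr -sumrB; apply: eq_bigr => i _.
by rewrite xcoord_pt !binR; field.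
Qed.

(** Coordinates with origin at the [j]-th top corner, pointing into the region. *)
Definition distc j x (i : 'I_k.+1) : R :=
  if unlift ord_max i is Some i' then (if i == j then n%:R - xcoord x i' else xcoord x i')
  else H%:R - zcoord x.

(* Intercepts of the cut at the [j]-th top corner; their product is L^j * b j. *)
Definition inter b j (i : 'I_k.+1) : nat :=
  if (i < j)%N then L else if i == j then b j else 1%N.

Definition lcor b j x : R := \sum_i distc j x i / (inter b j i)%:R - 1.

Definition ell b (c : site + 'I_k.+1) x : R :=
  match c with inl u => lsite u x | inr j => lcor b j x end.

(** A zero digit means no cut at that corner: the intercept would be 0 and [lcor] would divide by
    it. *)
Definition active (S : {set site}) b (c : site + 'I_k.+1) : bool :=
  match c with inl u => u \in S | inr j => (0 < b j)%N end.

Definition polyt (S : {set site}) b : set 'rV[R]_k.+1 :=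
  cut_set (active S b) (ell b) bowl.

Lemma xcoord_affine i : is_affine (fun x => xcoord x i).
Proof. exact: affine_coord. Qed.

Lemma zcoord_affine : is_affine (fun x : 'rV[R]_k.+1 => zcoord x).
Proof. exact: affine_coord. Qed.

Lemma ell_affine b c : is_affine (ell b c).
Proof.
case: c => [u|j] /=.
  apply: affineD; last exact: affine_cst.
  apply: affineD.
    apply: affineZ; apply: affineD; [exact: zcoord_affine|exact: affine_cst].
  apply: affineN; apply: affine_sum => i; apply: affineZ.
  by apply: affineD; [exact: xcoord_affine|exact: affine_cst].
apply: affineD; last exact: affine_cst.
apply: affine_sum => i x y t; rewrite /distc.
case: unliftP => [i' _|_]; last by rewrite zcoord_conv; ring.
by case: ifP => _; rewrite xcoord_conv; ring.
Qed.

Lemma polyt_convex S b : @convex_set R 'rV[R]_k.+1 (polyt S b).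
Proof. by apply: cut_set_convex; [exact: ell_affine|exact: bowl_convex]. Qed.

Lemma distc_ge0 j x i : bowl x -> 0 <= distc j x i.
Proof.
move=> /bowlP[Bx /andP[_ zx]]; rewrite /distc; case: unliftP => [i' _|_].
  by have /andP[x0 xn] := Bx i'; case: ifP => _; rewrite ?subr_ge0.
by rewrite subr_ge0.
Qed.

Section Bounded.
Variables (S : {set site}) (b : 'I_k.+1 -> nat).
Hypothesis b_le : forall j, (b j <= L)%N.

Lemma inter_bounds j i : (0 < b j)%N -> (0 < inter b j i <= L)%N.
Proof.
move=> bj; rewrite /inter; case: (i < j)%N; first by rewrite leqnn.
by case: (i == j); [apply/andP; split|].
Qed.

(** All intercepts are at most L, so one distance of L from the corner already suffices to be beyond
    the cut. *)
Lemma lcor_ge0 j x i : bowl x -> (0 < b j)%N -> L%:R <= distc j x i -> 0 <= lcor b j x.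
Proof.
move=> Kx bj Ld; have /andP[a0 aL] := inter_bounds i bj.
rewrite /lcor (bigD1 i) //= addrAC addr_ge0//.
  rewrite subr_ge0 ler_pdivlMr ?ltr0n// mul1r.
  by apply: le_trans Ld; rewrite ler_nat.
by apply: sumr_ge0 => i' _; rewrite divr_ge0// distc_ge0.
Qed.

Lemma lift_pt_bowl (y : 'I_k -> nat) : (forall i, (y i <= n)%N) -> bowl (lift_pt y).
Proof.
move=> yn.
have By i : 0 <= xcoord (lift_pt y) i <= n%:R by rewrite xcoord_pt ler0n ler_nat yn.
apply/bowlP; split => //; have := height_le By; have := H_geR R H_ge.
have := L_ge1 R M.
by rewrite {1}/lift_pt zcoord_pt /lift_pt height_pt_nat// lexx /=; lra.
Qed.

(** At a lifted lattice point [lsite] is the squared distance to the site minus 1, negative only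
    over the site itself. So each site cut loses just one lifted lattice point. *)
Lemma lift_pt_polyt (y : 'I_k -> nat) : (forall i, (y i <= n)%N) ->
  (forall u, u \in S -> exists i, y i != sitec u i) ->
  (polyt S b `&` lattice_pts (d := k.+1)) (lift_pt y).
Proof.
move=> yn yS; split; last exact: pt_lattice.
split; first exact: lift_pt_bowl.
move=> [u uS|j bj] /=.
  have [i yi] := yS u uS.
  rewrite lsite_lift_pt (bigD1 i) //= addrAC; apply: addr_ge0; last first.
    by apply: sumr_ge0 => ? _; exact: sqr_ge0.
  rewrite subr_ge0 -(ger0_norm (sqr_ge0 _)) normrX.
  apply: exprn_ege1; move: yi; rewrite neq_ltn => /orP[] yi.
    have : ((y i).+1%:R : R) <= (sitec u i)%:R by rewrite ler_nat.
    by rewrite -natr1 ler_normr => h; apply/orP; right; lra.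
  have : ((sitec u i).+1%:R : R) <= (y i)%:R by rewrite ler_nat.
  by rewrite -natr1 ler_normr => h; apply/orP; left; lra.
apply: (@lcor_ge0 _ _ ord_max) => //; first exact: lift_pt_bowl.
rewrite /distc unlift_none zcoord_pt.
have By i : 0 <= xcoord (lift_pt y) i <= n%:R by rewrite xcoord_pt ler0n ler_nat yn.
have := height_le By; have := H_geR R H_ge; have := L_ge1 R M.
by rewrite /lift_pt height_pt_nat// -/L -/n; lra.
Qed.

Definition corner_pt j (c : 'I_k.+1 -> nat) : 'rV[R]_k.+1 :=
  pt (fun i => if lift ord_max i == j then n%:R - (c (lift ord_max i))%:R
               else (c (lift ord_max i))%:R) (H%:R - (c ord_max)%:R).

Lemma distc_corner_pt j c i : distc j (corner_pt j c) i = (c i)%:R.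
Proof.
rewrite /distc /corner_pt; case: unliftP => [i' ->|->]; last first.
  by rewrite zcoord_pt subKr.
by rewrite xcoord_pt; case: (_ == j) => //; rewrite subKr.
Qed.

Lemma corner_pt_bowl j c : (forall i, (c i <= L)%N) -> bowl (corner_pt j c).
Proof.
move=> cL; have cLR i : (0 : R) <= (c i)%:R <= (L%:R : R).
  by rewrite ler0n ler_nat cL.
have nn : n%:R = 2 * L%:R :> R := nE R M.
have L1 : 1 <= L%:R :> R := L_ge1 R M.
have HR : (k * 'C(n, 2))%:R + L%:R + 1 <= H%:R :> R := H_geR R H_ge.
have Bx i : 0 <= xcoord (corner_pt j c) i <= n%:R.
  by rewrite xcoord_pt; have := cLR (lift ord_max i); case: ifP => _; lra.
apply/bowlP; split => //; have := height_le Bx; rewrite -/n.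
by rewrite zcoord_pt; have := cLR ord_max; lra.
Qed.

Lemma corner_pt_polyt j c : (forall i, (c i <= L)%N) ->
  0 <= lcor b j (corner_pt j c) ->
  (polyt S b `&` lattice_pts (d := k.+1)) (corner_pt j c).
Proof.
move=> cL lj; split; last first.
  apply/mxOverP => i0 i; rewrite mxE; case: unliftP => [i' _|_].
    by case: ifP => _; rewrite ?rpredB// natr_int.
  by rewrite rpredB// natr_int.
have Kc := corner_pt_bowl j cL; split => // -[u uS|j' bj'] /=.
  have /bowlP[Bx _] := Kc; have x0 i : 0 <= xcoord (corner_pt j c) i by case/andP: (Bx i).
  apply: le_trans (lsite_ge u x0); rewrite zcoord_pt.
  have n0 : 0 <= norm1 u (corner_pt j c) by apply: sumr_ge0.
  have := height_le Bx; have := H_geR R H_ge.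
  have : (c ord_max)%:R <= L%:R :> R by rewrite ler_nat.
  by rewrite -/n -/L; lra.
have [<- //|jj] := eqVneq j j'.
have nn : n%:R = 2 * L%:R :> R := nE R M.
have L1 : 1 <= L%:R :> R := L_ge1 R M.
have HR : (k * 'C(n, 2))%:R + L%:R + 1 <= H%:R :> R := H_geR R H_ge.
have [i ij] := corner_diff jj.
apply: (@lcor_ge0 _ _ (lift ord_max i)) => //.
have : (c (lift ord_max i))%:R <= L%:R :> R by rewrite ler_nat.
rewrite /distc liftK /corner_pt xcoord_pt.
by move: ij; case: (_ == j); case: (_ == j') => //= _; lra.
Qed.

Hypothesis k_gt0 : (0 < k)%N.

(** The cutting plane meets the corner in the simplex spanned by the integral intercepts, and the
    weights [w] are the barycentric coordinates of [x] there. *)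
Lemma corner_crossing j x : (0 < b j)%N -> bowl x -> lcor b j x = 0 ->
  conv_hull (polyt S b `&` lattice_pts (d := k.+1)) x.
Proof.
move=> bj Kx lx.
have a0 i : 0 < (inter b j i)%:R :> R.
  by rewrite ltr0n; case/andP: (inter_bounds i bj).
pose w i := distc j x i / (inter b j i)%:R.
pose c i i' := if i == i' then inter b j i else 0%N.
have sw : \sum_i w i = 1 by apply/eqP; rewrite -subr_eq0; apply/eqP.
have -> : x = \sum_i w i *: corner_pt j (c i).
  apply: row_xz => [i|].
    rewrite {2}/xcoord summxE.
    under eq_bigr => i' _ do rewrite mxE -/(xcoord _ i) xcoord_pt.
    have -> : xcoord x i = if lift ord_max i == j then n%:R - distc j x (lift ord_max i)
        else distc j x (lift ord_max i).
      by rewrite /distc liftK; case: (_ == j) => //; rewrite subKr.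
    have <- : \sum_i' w i' * (c i' (lift ord_max i))%:R = distc j x (lift ord_max i).
      rewrite (bigD1 (lift ord_max i)) //= big1 ?addr0 => [|i' /negbTE ii].
        by rewrite /c eqxx /w divfK// gt_eqF.
      by rewrite /c ii mulr0.
    case: (_ == j) => //; under [RHS]eq_bigr do rewrite mulrBr.
    by rewrite sumrB -mulr_suml sw mul1r.
  rewrite {2}/zcoord summxE.
  under eq_bigr => i' _ do rewrite mxE -/(zcoord _) zcoord_pt mulrBr.
  rewrite sumrB -mulr_suml sw mul1r.
  rewrite (bigD1 ord_max) //= big1 ?addr0 => [|i' /negbTE ii]; last first.
    by rewrite /c ii mulr0.
  by rewrite /c eqxx /w divfK ?gt_eqF// /distc unlift_none subKr.
apply: convex_sum => //; first exact: conv_hull_convex.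
  by move=> i; rewrite divr_ge0// ?distc_ge0// ltW.
move=> i; apply: conv_hull_sub; apply: corner_pt_polyt.
  by move=> i'; rewrite /c; case: ifP => // _; case/andP: (inter_bounds i bj).
rewrite /lcor (bigD1 i) //= distc_corner_pt /c eqxx divff ?gt_eqF// addrAC subrr add0r.
by apply: sumr_ge0 => i' _; rewrite distc_corner_pt divr_ge0.
Qed.

(** On the cutting hyperplane the l1 distance to the site is at most 1. Hence [x] is a convex
    combination of the lifts of the 2k neighbours: horizontal positions match by choice of the
    weights, heights because all these lifts lie on the hyperplane. *)
Lemma site_crossing u x : u \in S -> bowl x -> lsite u x = 0 ->
  conv_hull (polyt S b `&` lattice_pts (d := k.+1)) x.
Proof.
move=> uS Kx lx; have /bowlP[Bx /andP[hz zH]] := Kx.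
pose p i := sitec u i; pose y i : R := xcoord x i - (p i)%:R.
have pb i : (0 < p i < n)%N := sitec_bounds u i.
pose N := norm1 u x.
have N1 : N <= 1.
  have x0 i : 0 <= xcoord x i by case/andP: (Bx i).
  by have := lsite_ge u x0; rewrite lx -/N; lra.
pose nb (ie : 'I_k * bool) (i' : 'I_k) : nat :=
  if i' == ie.1 then (if ie.2 then (p i').+1 else (p i').-1) else p i'.
pose r : R := (1 - N) / (2 * k%:R).
have kr : k%:R * r = (1 - N) / 2.
  by rewrite /r; field; rewrite pnatr_eq0 -lt0n.
have r0 : 0 <= r by rewrite divr_ge0// ?subr_ge0// mulr_ge0.
pose w (ie : 'I_k * bool) : R := Num.max 0 (if ie.2 then y ie.1 else - y ie.1) + r.
have sumpair (F : 'I_k * bool -> R) : \sum_ie F ie = \sum_i (F (i, true) + F (i, false)).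
  rewrite (eq_bigr (fun ie => F (ie.1, ie.2))); last by case.
  rewrite -(pair_bigA _ (fun i e => F (i, e))) /=.
  by apply: eq_bigr => i _; rewrite big_bool.
have wD i : w (i, true) - w (i, false) = y i.
  by rewrite /w /= !max0E normrN; field.
have wS i : w (i, true) + w (i, false) = `|y i| + 2 * r.
  by rewrite /w /= !max0E normrN; field.
have sw : \sum_ie w ie = 1.
  rewrite sumpair (eq_bigr _ (fun i _ => wS i)) big_split /= sumr_const card_ord -[_ *+ k]mulr_natl.
  by rewrite mulrCA kr (_ : \sum_i _ = N)//; field.
have nbR ie i : (nb ie i)%:R = (p i)%:R + (if i == ie.1 then (if ie.2 then 1 else -1) else 0) :> R.
  rewrite /nb; case: eqP => [->|_]; last by rewrite addr0.
  have /andP[p0 _] := pb ie.1; case: ie.2; first by rewrite -natr1.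
  by rewrite -{2}(prednK p0) -natr1 addrK.
have nbn ie i : (nb ie i <= n)%N.
  have := pb i; rewrite /nb; case: eqP => _; first by case: ie.2; lia.
  by lia.
have nbz ie : (\sum_i 'C(nb ie i, 2))%:R = (\sum_i 'C(p i, 2))%:R +
    2^-1 + (if ie.2 then 1 else -1) * ((p ie.1)%:R - 2^-1) :> R.
  rewrite !natr_sum (bigD1 ie.1) //= [in RHS](bigD1 ie.1) //=.
  rewrite (eq_bigr (fun i => 'C(p i, 2)%:R)); last by move=> i /negbTE ii; rewrite /nb ii.
  by rewrite !binR nbR eqxx; case: ie.2; field.
have -> : x = \sum_ie w ie *: lift_pt (nb ie).
  apply: row_xz => [i|].
    rewrite {2}/xcoord summxE.
    under eq_bigr => ie _ do rewrite mxE -/(xcoord _ i) xcoord_pt nbR mulrDr.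
    rewrite big_split /= -mulr_suml sw mul1r sumpair (bigD1 i) //= eqxx big1 ?addr0.
      by rewrite mulr1 mulrN1 wD /y addrC subrK.
    by move=> i' /negbTE; rewrite eq_sym => ->; rewrite !mulr0 addr0.
  rewrite {2}/zcoord summxE.
  under eq_bigr => ie _ do rewrite mxE -/(zcoord _) zcoord_pt nbz mulrDr.
  rewrite big_split /= -mulr_suml sw mul1r sumpair /=.
  rewrite [X in _ = _ + X](eq_bigr (fun i => y i * ((p i)%:R - 2^-1))); last first.
    by move=> i _; rewrite mul1r mulN1r mulrN -mulrBl wD.
  move: lx; rewrite /lsite.
  have -> : \sum_i (2 * (sitec u i)%:R - 1) * (xcoord x i - (sitec u i)%:R) =
     2 * \sum_i y i * ((sitec u i)%:R - 2^-1).
    by rewrite mulr_sumr; apply: eq_bigr => i _; rewrite /y /p; field.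
  by rewrite /p; lra.
apply: convex_sum => //; first exact: conv_hull_convex.
  by move=> ie; rewrite addr_ge0// le_max lexx.
move=> ie; apply: conv_hull_sub; apply: lift_pt_polyt; first exact: nbn.
(* The shifted coordinate is even while site coordinates are odd, so a neighbour is never a site and
   survives every cut. *)
move=> u' u'S; exists ie.1; rewrite /nb eqxx /p /sitec.
by apply/eqP; case: ie.2; lia.
Qed.

Lemma polyt_hull : polyt S b = conv_hull (polyt S b `&` lattice_pts (d := k.+1)).
Proof.
apply/seteqP; split.
  apply: cut_set_lattice_hull => //; first exact: ell_affine.
  - exact: bowl_convex.
  - exact: bowl_lattice.
  - by move=> [u|j] x /= ac Kx lx; [exact: site_crossing lx|exact: corner_crossing lx].
apply: conv_hull_min; first exact: polyt_convex.
by move=> x [].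
Qed.

End Bounded.
End Cuts.

(** * Volumes of the polytopes *)

Section PolytVolume.
Variables (R : realType) (k M H : nat).
Let L := M.+1.
Let n := L.*2.
Notation bowl := (@bowl R k M H).
Notation site := (site k M).
Hypothesis H_ge : (k * 'C(n, 2) + L + 1 <= H)%N.
Implicit Types (u : site) (x : 'rV[R]_k.+1) (b : 'I_k.+1 -> nat) (j : 'I_k.+1).
Variables (S : {set site}) (b : 'I_k.+1 -> nat).
Hypothesis b_le : forall j, (b j <= L)%N.

Lemma eq_mule_fin (a c : R) (v : \bar R) : 0 < a -> c%:E = (a%:E * v)%E -> v = (c / a)%:E.
Proof.
move=> a0; case: v => [r| |].
- by rewrite -EFinM => -[->]; rewrite mulrC mulKf// gt_eqF.
- by rewrite gt0_muley.
- by rewrite gt0_muleNy.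
Qed.

Lemma measurable_xcoord i : measurable_fun setT (fun x : rowm R k.+1 => xcoord (x : 'rV_k.+1) i).
Proof. exact: measurable_coord. Qed.

Lemma measurable_zcoord : measurable_fun setT (fun x : rowm R k.+1 => zcoord (x : 'rV_k.+1)).
Proof. exact: measurable_coord. Qed.

Lemma measurable_lcor j : measurable_fun setT (fun x : rowm R k.+1 => lcor M H b j x).
Proof.
apply: measurable_funB => //; apply: measurable_sum => i.
apply: measurable_funM => //; rewrite /distc; case: unliftP => [i' _|_].
  case: (_ == j); last exact: measurable_xcoord.
  by apply: measurable_funB => //; exact: measurable_xcoord.
by apply: measurable_funB => //; exact: measurable_zcoord.
Qed.

Lemma measurable_lsite u : measurable_fun setT (fun x : rowm R k.+1 => lsite u x).
Proof.
apply: measurable_funB => //; apply: measurable_funB.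
  apply: measurable_funM => //; apply: measurable_funB => //; exact: measurable_zcoord.
apply: measurable_sum => i; apply: measurable_funM => //.
by apply: measurable_funB => //; exact: measurable_xcoord.
Qed.

Lemma measurable_bowl : measurable (bowl : set (rowm R k.+1)).
Proof.
apply: measurable_body => //.
by apply: continuous_measurable_fun; exact: continuous_qf.
Qed.

Definition cap (c : site + 'I_k.+1) : set (rowm R k.+1) :=
  [set x | bowl x /\ ell H b c x < 0].

Lemma measurable_cap c : measurable (cap c).
Proof.
apply: measurableI; first exact: measurable_bowl.
apply: measurable_set_ltr => //.
by case: c => [u|j]; [exact: measurable_lsite|exact: measurable_lcor].
Qed.

Lemma site_cap_norm1 u x : cap (inl u) x -> norm1 u x < 1 /\ zcoord x < height M x + 1.
Proof.
move=> [/bowlP[Bx /andP[hz _]] /= lx].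
have x0 i : 0 <= xcoord x i by case/andP: (Bx i).
have := lsite_ge u x0; have : 0 <= norm1 u x by apply: sumr_ge0.
by split; lra.
Qed.

Lemma corner_cap_lt j i x : (0 < b j)%N -> cap (inr j) x -> distc M H j x i < L%:R.
Proof.
move=> bj [Kx /=]; rewrite !ltNge; apply: contra => Ld.
exact: (lcor_ge0 b_le Kx bj Ld).
Qed.

(** Site caps project into open l1 unit balls whose centres differ by at least 2 in some coordinate.
    Corner caps extend less than L = n/2 along a separating axis. A site cap stays within 1 of the
    lower boundary, a corner cap within L of the roof. *)
Lemma caps_trivIset : trivIset [set c | active S b c] cap.
Proof.
apply/trivIsetP => c c' ac ac' cc'; apply/seteqP; split => // x [cx c'x].
have site_corner u j : (0 < b j)%N -> cap (inl u) x -> ~ cap (inr j) x.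
  move=> bj ux jx; have [_ zh] := site_cap_norm1 ux.
  have := corner_cap_lt ord_max bj jx; rewrite /distc unlift_none.
  have [/bowlP[Bx _] _] := ux; have := height_le Bx; have := H_geR R H_ge.
  by rewrite -/L -/n; lra.
case: c c' ac ac' cc' cx c'x => [u|j] [u'|j'] //= ac ac' cc' cx c'x.
- have [i ui] : exists i, u i != u' i.
    apply: contrapT => /forallNP uu; move: cc'; apply/negP/negPn/eqP; congr inl.
    by apply/ffunP => i; apply/eqP/negP => /negP /uu.
  have [N1 _] := site_cap_norm1 cx; have [N2 _] := site_cap_norm1 c'x.
  have le1 (v : site) : `|xcoord x i - (sitec v i)%:R| <= norm1 v x.
    rewrite /norm1 (bigD1 i) //= lerDl; exact: sumr_ge0.
  have := le1 u; have := le1 u'; rewrite !ler_norml => /andP[h1 h2] /andP[h3 h4].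
  have [h|h] : (sitec u i + 2 <= sitec u' i \/ sitec u' i + 2 <= sitec u i)%N.
    move: ui; rewrite -val_eqE /= /sitec; lia.
  + have : (sitec u i + 2)%N%:R <= (sitec u' i)%:R :> R by rewrite ler_nat.
    by rewrite natrD; lra.
  + have : (sitec u' i + 2)%N%:R <= (sitec u i)%:R :> R by rewrite ler_nat.
    by rewrite natrD; lra.
- exact: site_corner ac' cx c'x.
- exact: site_corner ac c'x cx.
- have jj : j != j' by apply: contraNneq cc' => ->.
  have [i ij] := corner_diff jj.
  have := corner_cap_lt (lift ord_max i) ac cx.
  have := corner_cap_lt (lift ord_max i) ac' c'x.
  have := nE R M; rewrite -/L -/n /distc liftK.
  by move: ij; case: (_ == j); case: (_ == j') => //= _; lra.
Qed.

(** The map [T] moves the site to the origin and takes [lsite + 1] as height, turning the cap into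
    the cone of points with l1 norm at most z and z < 1. Its Jacobian 2 accounts for the division by
    2. *)
Lemma vol_site_cap u : vol (cap (inl u)) = (2 ^+ k / 2 / k.+1`!%:R)%:E.
Proof.
pose E := body (k := k) setT (fun t : R => `|t|) true 0 1.
have mE : measurable (E : set (rowm R k.+1)).
  by apply: measurable_body => //; exact: normr_measurable.
pose p i : R := (sitec u i)%:R.
pose F : R := (\sum_i 'C(sitec u i, 2))%:R.
pose e := - 2 * F + \sum_i (2 * p i - 1) * p i.
pose T : 'rV[R]_k.+1 -> 'rV[R]_k.+1 :=
  shear (fun=> 1) (fun i => - p i) (fun i => - (2 * p i - 1)) 2 e.
have Tx x i : xcoord (T x) i = xcoord x i - p i by rewrite xcoord_pt mul1r.
have Tz x : zcoord (T x) = lsite u x + 1.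
  rewrite zcoord_pt /lsite subrK /e -/F.
  have -> : \sum_i (2 * (sitec u i)%:R - 1) * (xcoord x i - (sitec u i)%:R) =
      - \sum_i - (2 * p i - 1) * xcoord x i - \sum_i (2 * p i - 1) * p i.
    by rewrite -sumrN -sumrB; apply: eq_bigr => i _; rewrite /p; ring.
  by ring.
have Tn x : \sum_i `|xcoord (T x) i| = norm1 u x.
  by apply: eq_bigr => i _; rewrite Tx.
have -> : cap (inl u) = [set x | E (T x)].
  apply/seteqP; split => x /=.
    move=> [/bowlP[Bx /andP[hz _]] /= lx]; split => //.
    have x0 i : 0 <= xcoord x i by case/andP: (Bx i).
    have := lsite_ge u x0; rewrite itv_boundlr add0r Tn Tz => h.
    by apply/andP; split; rewrite ?bnd_simp; lra.
  move=> [_]; rewrite itv_boundlr add0r Tn Tz !bnd_simp => /andP[h1 h2].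
  have N1 : norm1 u x < 1 by lra.
  have x1 i : `|xcoord x i - p i| <= 1.
    apply: ltW; apply: le_lt_trans N1.
    by rewrite /norm1 (bigD1 i) //= lerDl; exact: sumr_ge0.
  have Bx i : 0 <= xcoord x i <= n%:R.
    have := x1 i; have /andP[p0 pn] := sitec_bounds u i.
    have : (1%:R : R) <= p i by rewrite ler_nat.
    have : ((sitec u i).+1%:R : R) <= n%:R by rewrite ler_nat.
    by rewrite ler_norml -natr1 -/(p i); lra.
  have lE := lsite_near x1; have := height_le Bx; have := H_geR R H_ge.
  have : 1 <= L%:R :> R := L_ge1 R M.
  have : 0 <= norm1 u x by apply: sumr_ge0.
  rewrite -/L -/n => h0 h3 h4 h5; split; last by rewrite /=; lra.
  by apply/bowlP; split => //; lra.
have vE : vol E = (2%:E * vol [set x | E (T x)])%E.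
  rewrite {1}(@vol_shear _ _ (fun=> 1) (fun i => - p i) (fun i => - (2 * p i - 1)) 2 e)//.
  by rewrite big1// mul1r ger0_norm.
move: vE; rewrite {1}/E vol_body_norm => /eq_mule_fin -> //.
rewrite /ppow subr0 max_r// expr1n; congr EFin; field.
by rewrite pnatr_eq0 -lt0n fact_gt0.
Qed.

(** Dividing the distances by the intercepts and taking their total as last coordinate carries the
    cap to the model simplex; the Jacobian is the inverse product of the intercepts. *)
Lemma vol_corner_cap j : (0 < b j)%N ->
  vol (cap (inr j)) = (\prod_i (inter M b j i)%:R / k.+1`!%:R)%:E.
Proof.
move=> bj.
have a0 i : 0 < (inter M b j i)%:R :> R.
  by rewrite ltr0n; case/andP: (inter_bounds b_le i bj).
pose E := body (k := k) `[0, +oo[ (@id R) true 0 1.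
have mE : measurable (E : set (rowm R k.+1)) by exact: measurable_body.
pose a i : R := (inter M b j i)%:R.
pose sg (i : 'I_k) : R := if lift ord_max i == j then -1 else 1.
pose bb (i : 'I_k) : R := if lift ord_max i == j then n%:R else 0.
pose al i := sg i / a (lift ord_max i).
pose be i := bb i / a (lift ord_max i).
pose g := - (a ord_max)^-1.
pose e := \sum_i be i + H%:R / a ord_max.
pose T : 'rV[R]_k.+1 -> 'rV[R]_k.+1 := shear al be al g e.
have Tx x i : xcoord (T x) i = distc M H j x (lift ord_max i) / a (lift ord_max i).
  rewrite xcoord_pt /distc liftK /al /be /sg /bb; case: (_ == j); by rewrite -/n; ring.
have Tz x : zcoord (T x) = \sum_i xcoord (T x) i + distc M H j x ord_max / a ord_max.
  rewrite zcoord_pt /distc unlift_none /e /g.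
  have -> : \sum_i xcoord (T x) i = \sum_i al i * xcoord x i + \sum_i be i.
    by rewrite -big_split; apply: eq_bigr => i _; rewrite xcoord_pt.
  by ring.
have Tl x : zcoord (T x) = lcor M H b j x + 1.
  rewrite Tz /lcor subrK big_lift_max; congr (_ + _).
  by apply: eq_bigr => i _; rewrite Tx.
have -> : cap (inr j) = [set x | E (T x)].
  apply/seteqP; split => x.
    move=> [Kx /= lx]; split => [i|].
      rewrite /= in_itv /= andbT Tx divr_ge0//.
      exact: distc_ge0.
    rewrite itv_boundlr !bnd_simp add0r; apply/andP; split; last by rewrite Tl; lra.
    by rewrite Tz lerDl divr_ge0//; exact: distc_ge0.
  move=> [x0]; rewrite itv_boundlr !bnd_simp add0r => /andP[h1 h2].
  have d0 i : 0 <= distc M H j x i / a i.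
    case: (unliftP ord_max i) => [i'|] ->; last by move: h1; rewrite Tz lerDl.
    by have := x0 i'; rewrite /= in_itv /= andbT Tx.
  have dL i : distc M H j x i < L%:R.
    have : distc M H j x i / a i < 1.
      move: h2; rewrite Tl /lcor subrK (bigD1 i) //= -/(a i).
      have : 0 <= \sum_(i' | i' != i) distc M H j x i' / (inter M b j i')%:R.
        by apply: sumr_ge0 => i' _; exact: d0.
      by lra.
    rewrite (ltr_pdivrMr _ _ (a0 i)) mul1r => /lt_le_trans; apply.
    by rewrite ler_nat; case/andP: (inter_bounds b_le i bj).
  have {}d0 i : 0 <= distc M H j x i.
    by have := d0 i; rewrite pmulr_lge0 ?invr_gt0 ?a0.
  have nn : n%:R = 2 * L%:R :> R := nE R M.
  have Bx i : 0 <= xcoord x i <= n%:R.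
    have := d0 (lift ord_max i); have := dL (lift ord_max i).
    by rewrite /distc liftK -/n; case: (_ == j); lra.
  have := height_le Bx; have := H_geR R H_ge; have := dL ord_max; have := d0 ord_max.
  rewrite /distc unlift_none -/L -/n => h3 h4 h5 h6; split; last by rewrite /= -(ltrD2r 1) -Tl add0r.
  by apply/bowlP; split => //; lra.
have vE : vol E = ((\prod_i a i)^-1%:E * vol [set x | E (T x)])%E.
  rewrite {1}(@vol_shear _ _ al be al g e)//.
  - have gE : `|g| = (a ord_max)^-1 by rewrite normrN normfV gtr0_norm// a0.
    rewrite normrM normr_prod gE big_lift_max invfM /=; congr ((_ * _)%:E * _)%E.
    rewrite -prodfV; apply: eq_bigr => i _; rewrite /al normrM normfV (gtr0_norm (a0 _)).
    by rewrite /sg; case: (_ == j); rewrite ?normrN normr1 mul1r.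
  - move=> i; apply: mulf_neq0; last by rewrite invr_eq0 gt_eqF// a0.
    by rewrite /sg; case: (_ == j); rewrite ?oppr_eq0 oner_neq0.
  - by rewrite oppr_eq0 invr_eq0 gt_eqF// a0.
move: vE; rewrite {1}/E vol_body_simplex => /eq_mule_fin -> //; last first.
  by rewrite invr_gt0; apply: prodr_gt0 => i _; exact: a0.
by rewrite /ppow subr0 max_r// expr1n invrK; congr EFin; rewrite mul1r mulrC.
Qed.

Lemma vol_polyt : (0 < k)%N -> vol (polyt H S b : set 'rV[R]_k.+1) =
  (n%:R ^+ k * H%:R - k%:R * n%:R ^+ k.-1 * \sum_(1 <= j < n) (n%:R - j%:R) ^+ 2 / 2
   - #|S|%:R * (2 ^+ k / 2 / k.+1`!%:R)
   - \sum_(j | (0 < b j)%N) (\prod_i (inter M b j i)%:R / k.+1`!%:R))%:E.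
Proof.
move=> k0; set V := (X in (X - _ - _)%:E).
have KV : vol bowl = V%:E.
  rewrite vol_body_qf//; first by rewrite /V subr0.
  have := H_geR R H_ge; rewrite subr0 natrM qf_max -/n -/L.
  by have : 0 <= L%:R :> R by []; lra.
pose U := \bigcup_(c in [set c | active S b c]) cap c.
have -> : polyt H S b = bowl `\` U.
  apply/seteqP; split => x [Kx].
    move=> lx; split => // -[c ac [_]]; rewrite ltNge; apply/negP/negPn; exact: lx.
  move=> nU; split => // c ac; rewrite leNgt; apply/negP => lx.
  by apply: nU; exists c.
have mU : measurable (U : set (rowm R k.+1)).
  apply: fin_bigcup_measurable; first exact: finite_finset.
  by move=> c _; exact: measurable_cap.
have UK : U `<=` bowl by move=> x [c _ []].
have := vol_setD measurable_bowl mU UK.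
rewrite KV /U vol_bigcup_fin; last 2 first.
- exact: measurable_cap.
- exact: caps_trivIset.
rewrite big_sumType /=.
rewrite (eq_bigr (fun=> (2 ^+ k / 2 / k.+1`!%:R)%:E)); last by move=> u _; exact: vol_site_cap.
rewrite [X in (_ + (_ + X))%E](eq_bigr (fun j => (\prod_i (inter M b j i)%:R / k.+1`!%:R)%:E)); last first.
  by move=> j bj; exact: vol_corner_cap.
rewrite !sumEFin -EFinD sumr_const -mulr_natl.
case: (vol _) => [r| |] //; rewrite -EFinD => -[->]; congr EFin; ring.
Qed.
End PolytVolume.

(** * Minimality of the volume *)

Section Equivalence.
Variables (R : realType) (d : nat).
Implicit Types (P Q : set 'rV[R]_d).

Lemma affinely_equivalent_refl P : affinely_equivalent P P.
Proof.
exists 1%:M, 0; apply/seteqP; split => [_ [x Px <-]|x Px].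
  by rewrite mulmx1 addr0.
by exists x => //; rewrite mulmx1 addr0.
Qed.

Lemma full_dimensional_unitmx P Q (A : 'M[R]_d) v :
  [set x *m A + v | x in P] = Q -> full_dimensional Q -> A \in unitmx.
Proof.
move=> <- [q [N [[a Pa aq] qN uN]]].
have /choice[f fN] : forall i, exists x, x *m A + v = q + row i N.
  by move=> i; have [x _ xE] := qN i; exists x.
suff : N = (\matrix_i (f i - a)) *m A.
  by move=> NE; move: uN; rewrite NE unitmx_mul => /andP[].
apply/row_matrixP => i; rewrite row_mul rowK mulmxBl.
have -> : row i N = (q + row i N) - q by rewrite addrC addKr.
by rewrite -fN -aq opprD addrACA subrr addr0.
Qed.

Lemma affinely_equivalent_trans P Q T :
  affinely_equivalent P Q -> affinely_equivalent Q T -> affinely_equivalent P T.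
Proof.
move=> [A [v AE]] [B [w BE]]; exists (A *m B), (v *m B + w).
rewrite -BE -AE; apply/seteqP; split => [_ [x Px <-]|_ [_ [x Px <-] <-]].
  by exists (x *m A + v); [exists x|rewrite mulmxDl mulmxA addrA].
by exists x => //; rewrite mulmxDl mulmxA addrA.
Qed.

Lemma affinely_equivalent_sym P Q : full_dimensional Q ->
  affinely_equivalent P Q -> affinely_equivalent Q P.
Proof.
move=> fQ [A [v AE]]; have uA := full_dimensional_unitmx AE fQ.
exists (invmx A), (- (v *m invmx A)).
rewrite -AE; apply/seteqP; split => [_ [_ [x Px <-] <-]|x Px].
  by rewrite mulmxDl mulmxK// addrK.
by exists (x *m A + v); [exists x|rewrite mulmxDl mulmxK// addrK].
Qed.

Lemma affine_class_eq P Q : lattice_polytope Q -> affinely_equivalent P Q ->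
  affine_class P = affine_class Q.
Proof.
move=> [_ fQ] PQ; apply/seteqP; split => T [lT eT]; split => //.
  by apply: affinely_equivalent_trans eT; exact: affinely_equivalent_sym.
exact: affinely_equivalent_trans PQ eT.
Qed.
End Equivalence.

(** * A unimodular frame of vertices *)

Section Frame.
Variables (R : realType) (k M H : nat).
Let L := M.+1.
Let n := L.*2.
Notation bowl := (@bowl R k M H).
Notation site := (site k M).
Hypothesis H_ge : (k * 'C(n, 2) + L + 1 <= H)%N.
Hypothesis k_gt0 : (0 < k)%N.
Hypothesis M_gt0 : (0 < M)%N.
Variables (S : {set site}) (b : 'I_k.+1 -> nat).
Hypothesis b_le : forall j, (b j <= L)%N.
Notation P := (@polyt R k M H S b).

(** A supporting function of the lower boundary at the lift of [y], equal to [lsite + 1] over a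
    site. It vanishes in the region only at that lift, which is therefore an exposed vertex. *)
Definition tangent (y : 'I_k -> nat) (x : 'rV[R]_k.+1) : R :=
  2 * (zcoord x - (\sum_i 'C(y i, 2))%:R) - \sum_i (2 * (y i)%:R - 1) * (xcoord x i - (y i)%:R).

Lemma tangent_affine y : is_affine (tangent y).
Proof.
apply: affineD.
  apply: affineZ; apply: affineD; [exact: zcoord_affine|exact: affine_cst].
apply: affineN; apply: affine_sum => i; apply: affineZ.
by apply: affineD; [exact: xcoord_affine|exact: affine_cst].
Qed.

Lemma tangent_ge y x : (forall i, (y i < n)%N) -> bowl x ->
  \sum_i `|xcoord x i - (y i)%:R| + 2 * (zcoord x - height M x) <= tangent y x.
Proof.
move=> yn /bowlP[Bx _]; rewrite /tangent /height.
suff : (\sum_i 'C(y i, 2))%:R + \sum_i ((y i)%:R - 2^-1) * (xcoord x i - (y i)%:R)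
    + (\sum_i `|xcoord x i - (y i)%:R|) / 2 <= \sum_i qf n (xcoord x i).
  have -> : \sum_i (2 * (y i)%:R - 1) * (xcoord x i - (y i)%:R) =
     2 * \sum_i ((y i)%:R - 2^-1) * (xcoord x i - (y i)%:R).
    by rewrite mulr_sumr; apply: eq_bigr => i _; field.
  by rewrite -/n; lra.
rewrite natr_sum mulr_suml -!big_split /=; apply: ler_sum => i _.
by apply: qf_support => //; case/andP: (Bx i).
Qed.

Lemma tangent_lift_pt y : tangent y (lift_pt R y) = 0.
Proof.
rewrite /tangent zcoord_pt subrr mulr0 sub0r big1 ?oppr0// => i _.
by rewrite xcoord_pt subrr mulr0.
Qed.

Lemma tangent_ge0 y x : (forall i, (y i < n)%N) -> bowl x -> 0 <= tangent y x.
Proof.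
move=> yn Kx; apply: le_trans (tangent_ge yn Kx).
have /bowlP[_ /andP[hz _]] := Kx.
by rewrite addr_ge0 ?sumr_ge0// mulr_ge0// subr_ge0.
Qed.

Lemma tangent_eq0 y x : (forall i, (y i < n)%N) -> bowl x -> tangent y x = 0 -> x = lift_pt R y.
Proof.
move=> yn Kx tx; have := tangent_ge yn Kx; rewrite tx.
have /bowlP[_ /andP[hz _]] := Kx.
set N := \sum_i _ => h.
have N0 : N = 0.
  have : 0 <= N by apply: sumr_ge0.
  by lra.
have xy i : xcoord x i = (y i)%:R.
  move/eqP: N0; rewrite psumr_eq0// => /allP /(_ i); rewrite mem_index_enum => /(_ isT).
  by rewrite normr_eq0 subr_eq0 => /eqP.
apply: row_xz => [i|]; first by rewrite xcoord_pt.
have s0 : \sum_i (2 * (y i)%:R - 1) * (xcoord x i - (y i)%:R) = 0.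
  by rewrite big1// => i _; rewrite xy subrr mulr0.
by rewrite zcoord_pt; move: tx; rewrite /tangent s0; lra.
Qed.

Lemma small_lift_pt (y : 'I_k -> nat) : (forall i, (y i <= 2)%N) ->
  (P `&` lattice_pts (d := k.+1)) (lift_pt R y).
Proof.
move=> y2; apply: lift_pt_polyt => //.
  by move=> i; apply: leq_trans (y2 i) _; rewrite /n /L; lia.
move=> u _; exists (Ordinal k_gt0); have := y2 (Ordinal k_gt0).
by rewrite /sitec; lia.
Qed.

Lemma small_lift_pt_image (y : 'I_k -> nat) (A : 'M[R]_k.+1) v X : (forall i, (y i <= 2)%N) ->
  A \in unitmx -> [set x *m A + v | x in P] = conv_hull X -> X (lift_pt R y *m A + v).
Proof.
move=> y2 uA PX; have yn i : (y i < n)%N.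
  by apply: leq_ltn_trans (y2 i) _; rewrite /n /L; lia.
apply: (exposed_image (@tangent_affine y)) PX => //.
- by have [] := small_lift_pt y2.
- exact: tangent_lift_pt.
- by move=> x [Kx _]; exact: tangent_ge0.
- by move=> x [Kx _]; exact: tangent_eq0.
Qed.

(** The lifts of the unit vectors have height 0, and that of twice the first one has height C(2, 2)
    = 1. The last row thus supplies the vertical direction, and the frame matrix is triangular with
    unit diagonal. *)
Definition frame_idx (i : 'I_k.+1) (i' : 'I_k) : nat :=
  if unlift ord_max i is Some i1 then (i' == i1)%N
  else (i' == Ordinal k_gt0).*2.

Definition frame : 'M[R]_k.+1 := \matrix_i lift_pt R (frame_idx i).

Lemma frame_idx_le i i' : (frame_idx i i' <= 2)%N.
Proof. by rewrite /frame_idx; case: unliftP => *; case: (_ == _). Qed.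

Lemma lift_pt0 : lift_pt R (fun=> 0%N : nat) = 0 :> 'rV_k.+1.
Proof.
apply: row_xz => [i|]; first by rewrite xcoord_pt /xcoord mxE.
by rewrite zcoord_pt /zcoord mxE big1.
Qed.

Lemma det_frame : \det frame = 1.
Proof.
rewrite det_trig.
  rewrite big1// => i _; rewrite mxE; case: (unliftP ord_max i) => [i1|] ->.
    rewrite -[LHS]/(xcoord _ i1) xcoord_pt /frame_idx liftK eqxx//.
  rewrite -[LHS]/(zcoord _) zcoord_pt (bigD1 (Ordinal k_gt0)) //= big1.
    by rewrite /frame_idx unlift_none eqxx.
  by move=> i2 /negbTE ii; rewrite /frame_idx unlift_none ii.
apply/is_trig_mxP => i j ij; rewrite mxE.
case: (unliftP ord_max i) ij => [i1|] ->; last by rewrite ltnNge -ltnS ltn_ord.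
case: (unliftP ord_max j) => [j1|] -> ij.
  rewrite -[LHS]/(xcoord _ j1) xcoord_pt /frame_idx liftK.
  by case: eqP => // jj; move: ij; rewrite jj ltnn.
rewrite -[LHS]/(zcoord _) zcoord_pt big1// => i' _.
by rewrite /frame_idx liftK; case: (_ == _).
Qed.

Lemma polyt_full_dimensional : full_dimensional P.
Proof.
exists 0, frame; split.
- by rewrite -lift_pt0; have [] := @small_lift_pt (fun=> 0%N).
- move=> i; rewrite add0r rowK.
  by have [] := small_lift_pt (frame_idx_le i).
- by rewrite unitmxE det_frame unitr1.
Qed.

Definition box_pt (f : {ffun 'I_k -> 'I_n.+1} * 'I_H.+1) : 'rV[R]_k.+1 :=
  pt (fun i => (f.1 i)%:R) (f.2)%:R.

Lemma int_itv (x : R) (m : nat) : x \is a Num.int -> 0 <= x <= m%:R ->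
  exists i : 'I_m.+1, x = i%:R.
Proof.
move=> xi /andP[x0 xm].
have /natrP[a aE] : x \is a Num.nat by rewrite natrEint xi.
have am : (a < m.+1)%N by rewrite ltnS -(ler_nat R) -aE.
by exists (Ordinal am).
Qed.

Lemma bowl_lattice_box x : bowl x -> lattice_pts x -> exists f, x = box_pt f.
Proof.
move=> /bowlP[Bx /andP[hz zH]] /mxOverP ix.
have /choice[f fE] : forall i, exists j : 'I_n.+1, xcoord x i = j%:R.
  by move=> i; apply: int_itv; [exact: ix|exact: Bx].
have [z zE] : exists z : 'I_H.+1, zcoord x = z%:R.
  apply: int_itv; first exact: ix.
  rewrite zH andbT (le_trans _ hz)//; apply: sumr_ge0 => i _; exact: qf_ge0.
exists ([ffun i => f i], z); apply: row_xz => [i|].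
  by rewrite xcoord_pt ffunE.
by rewrite zcoord_pt.
Qed.

Lemma polyt_lattice_polytope : lattice_polytope P.
Proof.
split; last exact: polyt_full_dimensional.
exists (P `&` lattice_pts (d := k.+1)); split.
- apply: (@sub_finite_set _ _ (range box_pt)).
    by move=> x [[Kx _] lx]; have [f ->] := bowl_lattice_box Kx lx; exists f.
  exact: finite_image.
- by move=> x [].
- exact: polyt_hull.
Qed.

Lemma measurable_polyt : measurable (P : set (rowm R k.+1)).
Proof.
rewrite (_ : P = bowl `&` \bigcap_(c in [set c | active S b c]) [set x | 0 <= ell H b c x]).
  apply: measurableI; first exact: measurable_bowl.
  apply: fin_bigcap_measurable; first exact: finite_finset.
  move=> c _; apply: measurable_set_ler => //.
  by case: c => [u|j]; [exact: measurable_lsite|exact: measurable_lcor].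
by apply/seteqP; split => x [].
Qed.

(** The origin and the frame rows are vertices, so their images are integral. Then [v] and
    [frame *m A] are integral, and since the frame has determinant 1, the determinant of [A] is a
    nonzero integer. *)
Lemma polyt_min_vol : is_min_vol (affine_class P) (vol P).
Proof.
split.
  exists P => //; split; first exact: polyt_lattice_polytope.
  exact: affinely_equivalent_refl.
move=> Q [[[X [_ iX QX]] fQ] [A [v AE]]].
have uA := full_dimensional_unitmx AE fQ.
rewrite -AE vol_affine_image//; last exact: measurable_polyt.
have AX : [set x *m A + v | x in P] = conv_hull X by rewrite AE.
have iv : v \is a mxOver Num.int.
  apply: iX; rewrite -[v]add0r -(mul0mx _ A) -lift_pt0.
  exact: (small_lift_pt_image _ uA AX).
have iA : frame *m A \is a mxOver Num.int.
  apply/mxOverP => i j.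
  have : lift_pt R (frame_idx i) *m A + v \is a mxOver Num.int.
    apply: iX; apply: small_lift_pt_image AX => //; exact: frame_idx_le.
  move/mxOverP => /(_ 0 j); rewrite mxE.
  have -> : (frame *m A) i j = (lift_pt R (frame_idx i) *m A) 0 j.
    by rewrite -[lift_pt _ _](rowK (fun i => lift_pt R (frame_idx i))) -row_mul [RHS]mxE.
  move=> iij; move/mxOverP: iv => /(_ 0 j) ivj.
  by rewrite -[(_ *m _) 0 j](addrK (v 0 j)); exact: rpredB.
have iD : \det A \is a Num.int.
  rewrite -[\det A]mul1r -det_frame -det_mulmx.
  apply: rpred_sum => s _; apply: rpredM; first by rewrite rpredX// rpredN rpred1.
  by apply: rpred_prod => i _; exact: (mxOverP iA).
have D1 : 1 <= `|\det A|.
  by apply: norm_intr_ge1 => //; move: uA; rewrite unitmxE unitfE.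
rewrite -[leLHS]mul1e; apply: lee_wpmul2r; first exact: vol_ge0.
by rewrite lee_fin.
Qed.
End Frame.

(** * Finiteness of the set of classes *)

Section Finiteness.
Variable R : realType.

Lemma measurable_shear k (a b c : 'I_k -> R) g e :
  measurable_fun setT (shear a b c g e : rowm R k.+1 -> rowm R k.+1).
Proof.
apply: measurable_fun_row => j; under eq_fun do rewrite mxE.
case: unliftP => [i _|_].
  apply: measurable_funD => //; apply: measurable_funM => //; exact: measurable_coord.
apply: measurable_funD => //; apply: measurable_funD.
  apply: measurable_funM => //; exact: measurable_coord.
apply: measurable_sum => i; apply: measurable_funM => //; exact: measurable_coord.
Qed.

(** The affine image of the half-open standard simplex lies in [Q] by convexity. Read backwards, the
    volume of a polytope bounds the determinants of all simplices in it. *)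
Lemma vol_simplex_ge k (Q : set 'rV[R]_k.+1) p (N : 'M[R]_k.+1) :
  @convex_set R 'rV[R]_k.+1 Q -> Q p -> (forall i, Q (p + row i N)) ->
  ((`|\det N| / k.+1`!%:R)%:E <= vol Q)%E.
Proof.
move=> cQ Qp QN.
have [N0|N0] := eqVneq (\det N) 0; first by rewrite N0 normr0 mul0r vol_ge0.
have uN : N \in unitmx by rewrite unitmxE unitfE.
pose E := body (k := k) `[0, +oo[ (@id R) true 0 1.
have mE : measurable (E : set (rowm R k.+1)) by exact: measurable_body.
pose T : 'rV[R]_k.+1 -> 'rV[R]_k.+1 := shear (fun=> 1) (fun=> 0) (fun=> 1) 1 0.
pose E1 : set 'rV[R]_k.+1 := [set x | E (T x)].
have mE1 : measurable (E1 : set (rowm R k.+1)).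
  rewrite -[X in measurable X]setTI; exact: measurable_shear.
have vE1 : vol E1 = (1 / k.+1`!%:R)%:E.
  have a0 i : (fun=> 1 : R) (i : 'I_k) != 0 by exact: oner_neq0.
  have := vol_shear (fun=> 0) (fun=> 1) 0 a0 (oner_neq0 R) mE.
  rewrite big1// mul1r normr1 mul1e => <-.
  by rewrite vol_body_simplex /ppow subr0 max_r// expr1n.
have <- : vol [set x *m N + p | x in E1] = (`|\det N| / k.+1`!%:R)%:E.
  by rewrite vol_affine_image// vE1 -EFinM mul1r.
apply: le_vol => _ [x [x0 xz] <-].
have X0 i : 0 <= xcoord x i.
  by have := x0 i; rewrite /= in_itv /= andbT xcoord_pt mul1r addr0.
have [Z0 Z1] : 0 <= zcoord x /\ zcoord x + \sum_i xcoord x i <= 1.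
  move: xz; rewrite itv_boundlr !bnd_simp zcoord_pt add0r mul1r addr0.
  rewrite (eq_bigr (xcoord x)) => [|i _]; last by rewrite xcoord_pt mul1r addr0.
  by rewrite [X in _ + X](eq_bigr (xcoord x)) => [|i _]; rewrite ?mul1r//; lra.
have x_ge0 j : 0 <= x 0 j.
  by case: (unliftP ord_max j) => [i|] ->; [exact: X0|exact: Z0].
have x_le1 : \sum_j x 0 j <= 1 by rewrite big_lift_max /= addrC.
pose w (o : option 'I_k.+1) := if o is Some j then x 0 j else 1 - \sum_j x 0 j.
pose pp (o : option 'I_k.+1) := if o is Some j then p + row j N else p.
have sumo (V : zmodType) (F : option 'I_k.+1 -> V) : \sum_o F o = F None + \sum_j F (Some j).
  rewrite (bigD1 None) //=; congr (_ + _).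
  rewrite (reindex_omap Some id) /=; last by case.
  by apply: eq_bigl => j; rewrite eqxx.
have -> : x *m N + p = \sum_o w o *: pp o.
  have sE : \sum_j x 0 j *: (p + row j N) = (\sum_j x 0 j) *: p + \sum_j x 0 j *: row j N.
    by rewrite scaler_suml -big_split; apply: eq_bigr => j _; rewrite scalerDr.
  by rewrite sumo /= sE mulmx_sum_row scalerBl scale1r addrA subrK addrC.
apply: convex_sum => //; last by case.
- by case=> [j|]; rewrite /= ?subr_ge0.
- by rewrite sumo /= subrK.
Qed.

(** Full dimension only provides affinely independent points of the hull, not of [X]. If the
    differences of points of [X] did not span, the hull would satisfy a linear condition given by
    the cokernel, which the frame of the hull excludes. *)
Lemma hull_frame d (X : set 'rV[R]_d) : finite_set X -> full_dimensional (conv_hull X) ->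
  exists (x0 : 'rV[R]_d) (N : 'M[R]_d),
    [/\ X x0, forall i, X (x0 + row i N) & N \in unitmx].
Proof.
move=> fX [q [N0 [Xq XN uN0]]].
have [x0 Xx0] : exists x0, X x0.
  apply: contrapT => /forallNP nX; have : conv_hull X `<=` set0.
    apply: conv_hull_min; last by move=> x /nX.
    by apply/convexP.
  by move=> /(_ q Xq).
have /finite_seqP[xs xsX] := fX.
pose W : 'M[R]_(size xs, d) := \matrix_i (nth 0 xs i - x0).
have XW i : X (x0 + row i W).
  by rewrite rowK addrC subrK xsX /= mem_nth.
have fW : row_full W.
  rewrite -cokermx_eq0; pose C := cokermx W.
  have XC : conv_hull X `<=` [set y | (y - x0) *m C = 0].
    apply: conv_hull_min.
      apply/convexP => y z t /= Cy Cz _.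
      have -> : t *: y + (1 - t) *: z - x0 = t *: (y - x0) + (1 - t) *: (z - x0).
        by rewrite !scalerBr addrACA -opprD -scalerDl [t + _]addrC subrK scale1r.
      by rewrite mulmxDl -!scalemxAl Cy Cz !scaler0 addr0.
    move=> y; rewrite xsX /= => yxs.
    have iy : (index y xs < size xs)%N by rewrite index_mem.
    have -> : y - x0 = row (Ordinal iy) W by rewrite rowK nth_index.
    by rewrite -row_mul mulmx_coker row0.
  have : N0 *m C = 0.
    apply/row_matrixP => i; rewrite row_mul row0.
    have -> : row i N0 = (q + row i N0 - x0) - (q - x0).
      by rewrite opprB addrA subrK addrC addKr.
    by rewrite mulmxBl (XC _ (XN i)) (XC _ Xq) subrr.
  by move/(congr1 (mulmx (invmx N0))); rewrite mulmxA mulVmx// mul1mx mulmx0 => C0; apply/eqP; exact: C0.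
exists x0, (rowsub (fullrankfun fW) W); split => //.
  move=> i; rewrite (_ : row i _ = row (fullrankfun fW i) W); first exact: XW.
  by apply/rowP => j; rewrite !mxE.
exact: fullrowsub_unit.
Qed.

Definition subst_row d (N : 'M[R]_d) i (y : 'rV[R]_d) : 'M[R]_d :=
  \matrix_(a, c) if a == i then y 0 c else N a c.

Lemma cramer_row d (N : 'M[R]_d) (y : 'rV[R]_d) i : N \in unitmx ->
  (y *m invmx N) 0 i = \det (subst_row N i y) / \det N.
Proof.
move=> uN; rewrite /invmx uN -scalemxAr mxE mulrC; congr (_ / _).
rewrite mxE (expand_det_row _ i); apply: eq_bigr => j _.
rewrite !mxE eqxx; congr (_ * (_ * \det _)).
by apply/matrixP => a c; rewrite !mxE eq_sym (negbTE (neq_lift _ _)).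
Qed.

Lemma det_int d (N : 'M[R]_d) : N \is a mxOver Num.int -> \det N \is a Num.int.
Proof.
move=> iN; apply: rpred_sum => s _; apply: rpredM; first by rewrite rpredX// rpredN rpred1.
by apply: rpred_prod => i _; exact: (mxOverP iN).
Qed.

Definition grid_pt d m (g : {ffun 'I_d -> 'I_(m + m).+1 * 'I_m.+1}) : 'rV[R]_d :=
  \row_i ((((g i).1)%:R - m%:R) / ((g i).2)%:R).

(** In the coordinates of a frame taken from [X], Cramer's rule writes each coordinate as a quotient
    of two integral determinants. Both belong to simplices inside [Q], whose volume m/d! bounds them
    by m. The resulting grid hull serves only to name the class and need not be a lattice
    polytope. *)
Lemma affine_class_grid k m (P : set 'rV[R]_k.+1) : lattice_polytope P ->
  is_min_vol (affine_class P) (m%:R / k.+1`!%:R)%:E ->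
  exists Y : {set {ffun 'I_k.+1 -> 'I_(m + m).+1 * 'I_m.+1}},
    affine_class P = affine_class (conv_hull [set @grid_pt k.+1 m g | g in [set` Y]]).
Proof.
move=> lP [[Q [lQ PQ] vQ] _].
rewrite (affine_class_eq lQ PQ).
have [[X [fX iX QX]] fQ] := lQ.
have := fQ; rewrite QX => /(hull_frame fX) [x0 [N [Xx0 XN uN]]].
have iN : N \is a mxOver Num.int.
  apply/mxOverP => i j; have := iX _ (XN i) => /mxOverP /(_ 0 j).
  have := iX _ Xx0 => /mxOverP /(_ 0 j); rewrite !mxE => h1 h2.
  have -> : N i j = (x0 0 j + N i j) - x0 0 j by rewrite addrAC subrr add0r.
  exact: rpredB.
have XQ x : X x -> Q x by rewrite QX; exact: conv_hull_sub.
have cQ : @convex_set R 'rV[R]_k.+1 Q by rewrite QX; exact: conv_hull_convex.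
have dm (N' : 'M[R]_k.+1) : (forall i, Q (x0 + row i N')) -> `|\det N'| <= m%:R.
  move=> QN'; have := vol_simplex_ge cQ (XQ _ Xx0) QN'.
  by rewrite vQ lee_fin ler_pM2r// invr_gt0 ltr0n fact_gt0.
have dN0 : \det N != 0 by move: uN; rewrite unitmxE unitfE.
have [e eE] : exists e : 'I_m.+1, `|\det N| = e%:R.
  apply: int_itv; first by case: (ger0P (\det N)) => _; rewrite ?rpredN det_int.
  by rewrite normr_ge0 dm// => i; exact/XQ/XN.
have gridP x : X x -> exists g, (x - x0) *m invmx N = @grid_pt k.+1 m g.
  move=> Xx; have iy : x - x0 \is a mxOver Num.int.
    apply/mxOverP => a c; rewrite !mxE.
    by apply: rpredB; [exact: (mxOverP (iX _ Xx))|exact: (mxOverP (iX _ Xx0))].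
  (* The sign of the determinant of [N] goes into the numerator, leaving its absolute value [e] as
     denominator. *)
  have /choice[f fE] : forall i, exists a : 'I_(m + m).+1,
      Num.sg (\det N) * \det (subst_row N i (x - x0)) + m%:R = a%:R.
    move=> i; apply: int_itv.
      rewrite rpredD// ?natr_int// rpredM//.
        by rewrite sgr_def; case: (_ == 0); rewrite ?rpred0// rpredX// rpredN rpred1.
      apply: det_int; apply/mxOverP => a c; rewrite mxE.
      by case: ifP => _; exact: (mxOverP _).
    have : `|Num.sg (\det N) * \det (subst_row N i (x - x0))| <= m%:R.
      rewrite normrM normr_sg dN0 mul1r; apply: dm => a.
      have [->|ai] := eqVneq a i.
        rewrite (_ : row i _ = x - x0); first by rewrite addrC subrK; exact: XQ.
        by apply/rowP => c; rewrite !mxE eqxx.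
      rewrite (_ : row a _ = row a N); first exact/XQ/XN.
      by apply/rowP => c; rewrite !mxE (negbTE ai).
    by rewrite ler_norml natrD; lra.
  exists [ffun i => (f i, e)]; apply/rowP => i.
  rewrite cramer_row// mxE ffunE /= -fE -eE addrK.
  by rewrite normrEsg -mulf_div divff ?mul1r// sgr_eq0.
exists [set g | `[< exists2 x, X x & (x - x0) *m invmx N = grid_pt g >]]%SET.
set Y := [set grid_pt g | g in _].
have YE : Y = [set x *m invmx N + (- (x0 *m invmx N)) | x in X].
  apply/seteqP; split => [_ [g gY <-]|_ [x Xx <-]].
    move: gY; rewrite /= inE => /asboolP[x Xx xE]; exists x => //.
    by rewrite -xE mulmxBl.
  have [g gE] := gridP x Xx; exists g; last by rewrite -gE mulmxBl.
  by rewrite /= inE; apply/asboolP; exists x.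
rewrite -QX; apply/esym/affine_class_eq => //.
exists N, x0; rewrite YE conv_hull_image -QX.
apply/seteqP; split => [_ [_ [x Qx <-] <-]|x Qx].
  by rewrite mulmxDl mulmxKV// mulNmx mulmxKV// subrK.
exists (x *m invmx N - x0 *m invmx N); first by exists x.
by rewrite mulmxBl !mulmxKV// subrK.
Qed.

Lemma finite_affine_classes k m :
  finite_set [set affine_class P | P in
    [set P : set 'rV[R]_k.+1 | lattice_polytope P /\
      is_min_vol (affine_class P) (m%:R / (k.+1)`!%:R)%:E]].
Proof.
pose F (Y : {set {ffun 'I_k.+1 -> 'I_(m + m).+1 * 'I_m.+1}}) :=
  affine_class (conv_hull [set @grid_pt k.+1 m g | g in [set` Y]]).
apply: (@sub_finite_set _ _ (range F)); last exact: finite_image.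
by move=> _ [P [lP vP] <-]; have [Y ->] := affine_class_grid lP vP; exists Y.
Qed.
End Finiteness.

(** * Prescribing the volume *)

Lemma sum_digits (L r t : nat) : (0 < L)%N ->
  (\sum_(j < t) ((r %/ L ^ j) %% L) * L ^ j = r %% L ^ t)%N.
Proof.
move=> L0; elim: t => [|t IH]; first by rewrite big_ord0 expn0 modn1.
rewrite big_ord_recr /= IH.
set a := (r %/ L ^ t)%N.
have rE : r = (a %/ L * L ^ t.+1 + (a %% L * L ^ t + r %% L ^ t))%N.
  by rewrite addnA expnS mulnA -mulnDl -divn_eq -divn_eq.
rewrite [in RHS]rE modnMDl [RHS]modn_small; first by rewrite addnC.
have h1 : (r %% L ^ t < L ^ t)%N by rewrite ltn_mod expn_gt0 L0.
have h2 : (a %% L < L)%N by rewrite ltn_mod.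
apply: leq_trans (_ : (a %% L).+1 * L ^ t <= _)%N; first by rewrite mulSn [X in (_ < X)%N]addnC ltn_add2l.
by rewrite expnS leq_mul2r h2 orbT.
Qed.

Lemma prod_inter k M (b : 'I_k.+1 -> nat) j :
  (\prod_i inter M b j i = M.+1 ^ j * b j)%N.
Proof.
rewrite (bigD1 j) //= mulnC; congr (_ * _)%N; last by rewrite /inter ltnn eqxx.
transitivity (\prod_(i < k.+1 | (i < j)%N) M.+1)%N.
  rewrite [RHS]big_mkcond [LHS]big_mkcond; apply: eq_bigr => i _.
  rewrite /inter -val_eqE /=; case: (ltngtP i j) => //= _.
by rewrite (big_ord_narrow (ltnW (ltn_ord j))) prod_nat_const card_ord.
Qed.

Section Exact.
Variables (R : realType) (k M m : nat).
Let L := M.+1.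
Let n := L.*2.
Hypothesis k_gt0 : (0 < k)%N.

(** Volumes are scaled by d! to become integers: [base_vol] is a slab of height 1 over the box,
    [lower_vol] the region under the lower boundary, and a site cap counts 2^(k-1). The halved
    factorial is exact because (k+1)! is even for positive k. *)
Definition base_vol := (k.+1`! * n ^ k)%N.
Definition lower_vol := (k.+1`!./2 * k * n ^ k.-1 * \sum_(1 <= j < n) (n - j) ^ 2)%N.
Definition need_vol (s : nat) := (m + lower_vol + 2 ^ k.-1 * s)%N.
(** The needed volume over the slab volume, rounded up, so that the excess is less than one slab. *)
Definition top_height (s : nat) := ((need_vol s + base_vol.-1) %/ base_vol)%N.
Definition excess (s : nat) := (base_vol * top_height s - need_vol s)%N.
Definition digit (s : nat) (j : 'I_k.+1) := ((excess s %/ L ^ j) %% L)%N.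

(** The excess is below [base_vol], so this leaves it at most k + 1 = d digits in base L, one for
    each corner. *)
Hypothesis base_le : (base_vol <= L ^ k.+1)%N.
Hypothesis m_ge : (base_vol * (k * 'C(n, 2) + L + 1) <= m)%N.

Lemma base_gt0 : (0 < base_vol)%N.
Proof. by rewrite muln_gt0 fact_gt0 expn_gt0 double_gt0. Qed.

Lemma need_le s : (need_vol s <= base_vol * top_height s < need_vol s + base_vol)%N.
Proof.
rewrite /top_height; have b0 := base_gt0.
have := divn_eq (need_vol s + base_vol.-1) base_vol.
have := ltn_pmod (need_vol s + base_vol.-1) b0.
set q := (_ %/ _)%N; set r := (_ %% _)%N; rewrite [(base_vol * q)%N]mulnC; lia.
Qed.

Lemma excess_lt s : (excess s < L ^ k.+1)%N.
Proof.
apply: leq_trans base_le; have b0 := base_gt0.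
by have := need_le s; rewrite /excess; lia.
Qed.

Lemma top_height_ge s : (k * 'C(n, 2) + L + 1 <= top_height s)%N.
Proof.
have /andP[h _] := need_le s; rewrite -(leq_pmul2l base_gt0).
apply: leq_trans m_ge _; apply: leq_trans h.
by rewrite /need_vol -addnA leq_addr.
Qed.

Lemma digit_le s j : (digit s j <= L)%N.
Proof. by rewrite ltnW// ltn_mod. Qed.

Lemma top_height_le s : (top_height s <= need_vol s)%N.
Proof.
have /andP[_ h] := need_le s; have b0 := base_gt0.
rewrite leqNgt; apply/negP => ts.
have : (base_vol * (need_vol s).+1 <= base_vol * top_height s)%N by rewrite leq_pmul2l.
by rewrite mulnS; have := leq_pmull (need_vol s) b0; lia.
Qed.

Lemma vol_polyt_exact (S : {set site k M}) :
  vol (polyt (top_height #|S|) S (digit #|S|) : set 'rV[R]_k.+1) = (m%:R / k.+1`!%:R)%:E.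
Proof.
set s := #|S|.
rewrite vol_polyt//; [|exact: top_height_ge|exact: digit_le].
congr EFin; set f : R := k.+1`!%:R.
have f0 : f != 0 by rewrite pnatr_eq0 -lt0n fact_gt0.
have -> : \sum_(j < k.+1 | (0 < digit s j)%N) (\prod_i (inter M (digit s) j i)%:R / f : R) =
    (excess s)%:R / f.
  have <- : (\sum_(j < k.+1) digit s j * L ^ j = excess s)%N.
    by rewrite sum_digits// modn_small// excess_lt.
  rewrite natr_sum mulr_suml [RHS](bigID (fun j => 0 < digit s j)%N) /=.
  rewrite [X in _ = _ + X]big1 ?addr0 => [|j]; last first.
    by rewrite lt0n negbK => /eqP ->; rewrite mul0n mul0r.
  apply: eq_bigr => j _; congr (_ / _).
  by rewrite -natr_prod prod_inter mulnC.
have /andP[h1 h2] := need_le s.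
have e1 : (excess s)%:R = (base_vol * top_height s)%:R - (need_vol s)%:R :> R.
  by rewrite /excess natrB.
have two_f : f = 2 * (k.+1`!./2)%:R.
  rewrite /f -[in LHS](odd_double_half k.+1`!) (_ : odd _ = false) ?add0n -?mul2n ?natrM//.
  case: (k) k_gt0 => // k' _; rewrite factS oddM; apply/negbTE/nandP.
  by elim: k' => [|k' IH]; [left|right; rewrite factS oddM; apply/nandP; move: IH => []; rewrite /= ?negbK; tauto].
have p2 : 2 ^+ k = 2 * 2 ^+ k.-1 :> R by rewrite -exprS prednK.
have bE : base_vol%:R = f * n%:R ^+ k by rewrite /base_vol natrM natrX.
have lE : lower_vol%:R = (k.+1`!./2)%:R * k%:R * n%:R ^+ k.-1 *
    (\sum_(1 <= j < n) (n - j) ^ 2)%:R :> R.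
  by rewrite /lower_vol !natrM natrX.
have nE' : (need_vol s)%:R = m%:R + lower_vol%:R + 2 ^+ k.-1 * s%:R :> R.
  by rewrite /need_vol !natrD natrM natrX.
rewrite e1 natrM nE' bE lE p2.
have -> : \sum_(1 <= j < n) ((n%:R : R) - j%:R) ^+ 2 / 2 =
   (\sum_(1 <= j < n) (n - j) ^ 2)%:R / 2.
  rewrite natr_sum mulr_suml big_nat_cond [RHS]big_nat_cond.
  by apply: eq_bigr => j /andP[/andP[_ jn] _]; rewrite natrX natrB// ltnW.
rewrite -/s -/n -/L -/f.
set hf : R := (k.+1`!./2)%:R; rewrite -/hf in two_f.
have h0 : hf != 0 by move: f0; rewrite two_f mulf_eq0 negb_or => /andP[].
by rewrite two_f; field.
Qed.
End Exact.

(** * Counting classes *)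

Section Counting.
Variables (R : realType) (k M m Hmax : nat).
Let L := M.+1.
Let n := L.*2.
Hypothesis k_gt0 : (0 < k)%N.
Hypothesis M_gt0 : (0 < M)%N.
Hypothesis base_le : (base_vol k M <= L ^ k.+1)%N.
Hypothesis m_ge : (base_vol k M * (k * 'C(n, 2) + L + 1) <= m)%N.
Hypothesis Hmax_ge : forall S : {set site k M}, (top_height k M m #|S| <= Hmax)%N.

Definition family (S : {set site k M}) : set 'rV[R]_k.+1 :=
  polyt (top_height k M m #|S|) S (@digit k M m #|S|).

Let target := [set affine_class P | P in
  [set P : set 'rV[R]_k.+1 | lattice_polytope P /\
    is_min_vol (affine_class P) (m%:R / (k.+1)`!%:R)%:E]].

Lemma family_target S : target (affine_class (family S)).
Proof.
exists (family S) => //; split.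
  by apply: polyt_lattice_polytope => //; [exact: top_height_ge|exact: digit_le].
rewrite -(vol_polyt_exact R k_gt0 base_le m_ge S).
by apply: polyt_min_vol => //; [exact: top_height_ge|exact: digit_le].
Qed.

(** The set [S] can be read off the polytope: a site belongs to it exactly when its lift is
    missing. *)
Lemma family_inj : injective family.
Proof.
move=> S S' SS'; apply/setP => u.
have memE (T : {set site k M}) : (u \in T) <-> ~ family T (lift_pt R (sitec u)).
  split=> [uT [_ /(_ (inl u) uT)]|nT].
    rewrite /= lsite_lift_pt big1 => [|i _]; last by rewrite subrr expr0n.
    by rewrite sub0r lerNr oppr0 ler10.
  apply: contrapT => uT; apply: nT.
  have dl j : (@digit k M m #|T| j <= L)%N by exact: digit_le.
  have tg : (k * 'C(n, 2) + L + 1 <= top_height k M m #|T|)%N by exact: top_height_ge.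
  suff [] : (family T `&` lattice_pts (d := k.+1)) (lift_pt R (sitec u)) by [].
  apply: lift_pt_polyt => //.
    by move=> i; have /andP[_ /ltnW] := sitec_bounds u i.
  move=> u' u'T; apply: contrapT => /forallNP uu; apply: uT.
  suff -> : u = u' by [].
  apply/ffunP => i; apply/val_inj; have /negP/negPn/eqP := uu i.
  by rewrite /sitec => /eqP; rewrite eqn_add2r => /eqP /double_inj.
by apply/idP/idP => /memE h; apply/memE; rewrite ?SS'// -SS'.
Qed.

Let box := ({ffun 'I_k -> 'I_n.+1} * 'I_Hmax.+1)%type.

Lemma family_box S x : family S x -> lattice_pts x -> exists f : box, x = box_pt R f.
Proof.
move=> [/bowlP[Bx /andP[h1 h2]] _] lx; apply: bowl_lattice_box => //.
apply/bowlP; split => //; rewrite h1 (le_trans h2)// ler_nat; exact: Hmax_ge.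
Qed.

Definition frame_pt (o : option 'I_k.+1) : 'rV[R]_k.+1 :=
  if o is Some i then lift_pt R (frame_idx k_gt0 i) else lift_pt R (fun=> 0%N).

Lemma family_code S S' : affine_class (family S) = affine_class (family S') ->
  exists (g : {ffun option 'I_k.+1 -> box}) (A : 'M[R]_k.+1) v,
    [set x *m A + v | x in family S] = family S' /\
    forall o, frame_pt o *m A + v = box_pt R (g o).
Proof.
move=> SS'.
have lS' T : lattice_polytope (family T).
  by apply: polyt_lattice_polytope => //; [exact: top_height_ge|exact: digit_le].
have : affine_class (family S') (family S').
  by split; [exact: lS'|exact: affinely_equivalent_refl].
rewrite -SS' => -[_ [A [v AE]]].
have uA := full_dimensional_unitmx AE (lS' S').2.
have hull : family S' = conv_hull (family S' `&` lattice_pts (d := k.+1)).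
  by apply: polyt_hull => //; [exact: top_height_ge|exact: digit_le].
have AX : [set x *m A + v | x in family S] = conv_hull (family S' `&` lattice_pts (d := k.+1)).
  by rewrite AE.
have fo o : exists f : box, frame_pt o *m A + v = box_pt R f.
  have [] : (family S' `&` lattice_pts (d := k.+1)) (frame_pt o *m A + v).
    case: o => [i|] /=.
      apply: small_lift_pt_image AX => //.
      - exact: top_height_ge.
      - exact: digit_le.
      - exact: frame_idx_le.
    apply: small_lift_pt_image AX => //; [exact: top_height_ge|exact: digit_le].
  exact: family_box.
have [g gE] := choice fo.
by exists [ffun o => g o], A, v; split => // o; rewrite ffunE.
Qed.

Lemma frame_determines (A A' : 'M[R]_k.+1) v v' :
  (forall o, frame_pt o *m A + v = frame_pt o *m A' + v') -> A = A' /\ v = v'.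
Proof.
move=> H.
have vv : v = v' by have := H None; rewrite /= lift_pt0 !mul0mx !add0r.
split=> //; subst v'.
have uF : frame R k_gt0 \in unitmx by rewrite unitmxE det_frame unitr1.
rewrite -[A](mulKmx uF) -[A'](mulKmx uF); congr (_ *m _).
apply/row_matrixP => i; rewrite !row_mul !rowK.
exact: (addIr v (H (Some i))).
Qed.

(** A set [S] is encoded by the class of its polytope and the images of the k + 2 frame points under
    an affine map from a fixed member of that class. These images determine the map, and each lies
    in a box of lattice points common to the family. *)
Lemma classes_count :
  (2 ^ (M ^ k) <= num_classes R k.+1 m * ((n.+1 ^ k * Hmax.+1) ^ k.+2))%N.
Proof.
have fT : finite_set target by exact: finite_affine_classes.
pose T := fset_set target.
have cT S : affine_class (family S) \in T.
  by rewrite in_fset_set// inE; exact: family_target.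
pose cls S : T := [` cT S]%fset.
(* The representative must depend on the class alone, or equal codes would not give equal sets. *)
pose rep S := odflt S [pick S' | cls S' == cls S].
have repE S : cls (rep S) = cls S.
  rewrite /rep; case: pickP => [S' /eqP //|/(_ S)]; by rewrite eqxx.
have rep_eq S S' : cls S = cls S' -> rep S = rep S'.
  move=> SS'; rewrite /rep -SS'; case: pickP => // /(_ S).
  by rewrite eqxx.
have code S : exists g : {ffun option 'I_k.+1 -> box}, exists A : 'M[R]_k.+1, exists v,
    [set x *m A + v | x in family (rep S)] = family S /\
    forall o, frame_pt o *m A + v = box_pt R (g o).
  by apply: family_code; exact: (congr1 val (repE S)).
have [g gP] := choice code.
pose F S := (cls S, g S).
have injF : injective F.
  move=> S S' [SS' gg]; apply: family_inj.
  have [A [v [<- Av]]] := gP S; have [A' [v' [<- Av']]] := gP S'.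
  have [-> ->] : A = A' /\ v = v'.
    by apply: frame_determines => o; rewrite Av Av' gg.
  have -> : rep S = rep S' by apply: rep_eq; exact: val_inj.
  by [].
have := leq_card F injF.
rewrite card_prod card_ffun card_option !card_prod !card_ffun !card_ord -cardfE.
by rewrite -cardsT -powersetT card_powerset cardsT card_ffun !card_ord.
Qed.
End Counting.

(** * Choice of L and the logarithmic estimate *)

Section Asymptotics.
Variables (R : realType) (k : nat).
Hypothesis k_gt0 : (0 < k)%N.

(** [C1] comes from base_vol times (2k + 2)L^2, the bound used for the least admissible [m]. [C2]
    adds up bounds for [m], [lower_vol] and the site caps, in units of L^(k+2). [C3] absorbs n + 1
    <= 3L and [Hmax.+1] <= 2 [Hmax] in the box size. *)
Let C1 := (k.+1`! * 2 ^ k * (2 * k + 2))%N.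
Let C2 := (C1 * 2 ^ k.+2 + k.+1`! * k * 2 ^ k.+2 + 2 ^ k)%N.
Let C3 := (3 ^ k * (2 * C2))%N.

Lemma base_volE M : base_vol k M = (k.+1`! * 2 ^ k * M.+1 ^ k)%N.
Proof. by rewrite /base_vol -mul2n expnMn mulnA. Qed.

Lemma lower_vol_le M : (lower_vol k M <= k.+1`! * k * 2 ^ k.+2 * M.+1 ^ k.+2)%N.
Proof.
rewrite /lower_vol; set n := M.+1.*2.
have Wn : (\sum_(1 <= j < n) (n - j) ^ 2 <= n ^ 3)%N.
  apply: (@leq_trans (\sum_(1 <= j < n) n ^ 2)).
    by apply: leq_sum => j _; rewrite leq_exp2r// leq_subr.
  rewrite sum_nat_const_nat expnS leq_mul2r; apply/orP; right; lia.
have -> : (k.+1`! * k * 2 ^ k.+2 * M.+1 ^ k.+2 = k.+1`! * k * n ^ k.-1 * n ^ 3)%N.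
  have nk : (n ^ k.-1 * n ^ 3 = n ^ k.+2)%N.
    by rewrite -expnD; congr (_ ^ _)%N; case: (k) k_gt0 => // k' _; rewrite /=; lia.
  by rewrite -[RHS]mulnA nk /n -mul2n expnMn !mulnA.
apply: leq_mul => //; apply: leq_mul => //; apply: leq_mul => //.
by rewrite -{2}(odd_double_half k.+1`!); lia.
Qed.

Lemma count_lower m M : (0 < M)%N -> (k.+1`! * 2 ^ k <= M.+1)%N ->
  (C1 * M.+1 ^ k.+2 <= m < C1 * M.+2 ^ k.+2)%N ->
  (2 ^ (M ^ k) <= num_classes R k.+1 m * (C3 * M.+1 ^ (2 * k + 2)) ^ k.+2)%N.
Proof.
move=> M0 ML /andP[m1 m2]; set L := M.+1 in ML m1 *.
have base_le : (base_vol k M <= L ^ k.+1)%N by rewrite base_volE expnS leq_mul2r ML orbT.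
have m_ge : (base_vol k M * (k * 'C(L.*2, 2) + L + 1) <= m)%N.
  apply: leq_trans m1; rewrite base_volE /C1 -/L.
  rewrite -[X in (X <= _)%N]mulnA -[X in (_ <= X)%N]mulnA leq_mul2l; apply/orP; right.
  have -> : (L ^ k.+2 = L ^ k * L ^ 2)%N by rewrite -expnD addn2.
  rewrite mulnCA leq_mul2l; apply/orP; right.
  have cL : ('C(L.*2, 2) <= 2 * L ^ 2)%N.
    rewrite bin2; apply: (@leq_trans ((L.*2 * L.*2)./2)).
      by apply: half_leq; rewrite leq_mul2l leq_pred orbT.
    by rewrite -doubleMl doubleK -mul2n mulnCA mulnn.
  have := leq_mul (leqnn k) cL; have : (L + 1 <= 2 * L ^ 2)%N by rewrite expnS expn1 /L; nia.
  by nia.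
pose Hmax := (C2 * L ^ k.+2)%N.
have Hmax_ge (S : {set site k M}) : (top_height k M m #|S| <= Hmax)%N.
  apply: (@leq_trans (need_vol k M m #|S|)); first exact: top_height_le.
  rewrite /need_vol /Hmax.
  have -> : (C2 * L ^ k.+2 = C1 * 2 ^ k.+2 * L ^ k.+2 +
      k.+1`! * k * 2 ^ k.+2 * L ^ k.+2 + 2 ^ k * L ^ k.+2)%N.
    by rewrite /C2 mulnDl; congr (_ + _)%N; rewrite mulnDl.
  apply: leq_add; first apply: leq_add.
  - apply: leq_trans (ltnW m2) _; rewrite -mulnA leq_mul2l -expnMn; apply/orP; right.
    by rewrite leq_exp2r// /L; lia.
  - exact: lower_vol_le.
  - apply: leq_mul; first by rewrite leq_exp2l// leq_pred.
    apply: leq_trans (max_card _) _; rewrite card_ffun !card_ord.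
    apply: (@leq_trans (L ^ k)); first by rewrite leq_exp2r// /L.
    by apply: leq_pexp2l => //; exact: leqW.
apply: leq_trans (classes_count R k_gt0 M0 base_le m_ge Hmax_ge) _.
rewrite leq_mul2l; apply/orP; right; rewrite leq_exp2r//.
rewrite /C3 (_ : 2 * k + 2 = k + k.+2)%N; last by lia.
rewrite expnD mulnACA -expnMn; apply: leq_mul.
  by rewrite leq_exp2r// -/L /L; lia.
have : (0 < Hmax)%N by rewrite /Hmax /C2 muln_gt0 addn_gt0 !expn_gt0 orbT.
by rewrite -mulnA -/Hmax; lia.
Qed.

Lemma ln_le_sub1 (x : R) : 0 < x -> ln x <= x - 1.
Proof.
move=> x0; have := expR_ge1Dx (ln x); rewrite lnK ?posrE//; lra.
Qed.

(** Lets the logarithm of the polynomial multiplicity be absorbed into an arbitrarily small multiple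
    of L. *)
Lemma ln_linear (eps : R) (x : R) : 0 < eps -> 0 < x -> ln x <= eps * x - ln eps.
Proof.
move=> e0 x0; have := ln_le_sub1 (mulr_gt0 e0 x0).
by rewrite lnM ?posrE//; lra.
Qed.

Lemma asymptotic_bound : exists (c : R) (m0 : nat), forall m : nat, (m0 <= m)%N ->
  m%:R `^ (k%:R / (k%:R + 2)) <= c * ln (num_classes R k.+1 m)%:R.
Proof.
(* There are M^k sites, and M >= L/2 costs the factor 2^k. *)
pose al : R := ln 2 / 2 ^+ k.
have al0 : 0 < al by rewrite divr_gt0 ?exprn_gt0// ln_gt0// ltr1n.
pose E : R := k.+2%:R * (2 * k + 2)%:R.
have E0 : 0 < E by rewrite mulr_gt0// ltr0n; lia.
(* With this choice [E * eps] is [al / 4]; together with [K <= al / 4 * l], ensured by [L0], the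
   error terms take at most half of the main term. *)
pose eps := al / (4 * E).
have e0 : 0 < eps by rewrite divr_gt0// mulr_gt0.
pose K : R := k.+2%:R * ln C3%:R - E * ln eps.
have C1_gt0 : (0 < C1)%N by rewrite !muln_gt0 fact_gt0 expn_gt0 /=; lia.
have C3_gt0 : (0 < C3)%N.
  by rewrite muln_gt0 expn_gt0 /= muln_gt0 /= /C2 !addn_gt0 !expn_gt0 orbT.
pose L0 := maxn (maxn 2 (k.+1`! * 2 ^ k)) (Num.truncn (4 * K / al)).+1.
exists ((2 * C1%:R) ^+ k * (2 / al)), (C1 * L0 ^ k.+2)%N => m m0m.
have exL : exists L, (C1 * L ^ k.+2 <= m)%N by exists L0.
have bL L : (C1 * L ^ k.+2 <= m)%N -> (L <= m)%N.
  move=> h; apply: leq_trans h; case: L => // L.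
  by apply: leq_trans (leq_pmull _ C1_gt0); rewrite expnS leq_pmulr// expn_gt0.
(* Maximality bounds [m] by [C1] times (L+1)^(k+2), so L has the order of m^(1/(k+2)). *)
pose L := ex_maxn exL bL.
have [Lm Lmax] : (C1 * L ^ k.+2 <= m)%N /\ (forall j, (C1 * j ^ k.+2 <= m)%N -> (j <= L)%N).
  by rewrite /L; case: ex_maxnP.
have L0L : (L0 <= L)%N by exact: Lmax.
have [L2 [Lf LK]] : (2 <= L)%N /\ (k.+1`! * 2 ^ k <= L)%N /\ 4 * K / al <= L%:R.
  move: L0L; rewrite !geq_max -andbA => /and3P[-> -> h]; split=> //; split=> //.
  apply: ltW; apply: lt_le_trans (_ : (Num.truncn (4 * K / al)).+1%:R <= _); last by rewrite ler_nat.
  exact: truncnS_gt.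
have mlt : (m < C1 * L.+1 ^ k.+2)%N.
  by rewrite ltnNge; apply/negP => /Lmax; rewrite ltnn.
case: L Lm Lmax L0L L2 Lf LK mlt => // M Lm _ _ M1 Lf LK mlt.
have cnt := count_lower (m := m) M1 Lf.
rewrite Lm mlt in cnt; move/(_ isT): cnt.
set N := num_classes R k.+1 m => cnt.
have N0 : (0 < N)%N.
  by move: (expn_gt0 2 (M ^ k)) => /= /leq_trans /(_ cnt); rewrite muln_gt0 => /andP[].
pose l : R := M.+1%:R.
have l0 : 0 < l by rewrite ltr0n.
have lnN : M%:R ^+ k * ln 2 <= ln N%:R + k.+2%:R * (ln C3%:R + (2 * k + 2)%:R * ln l).
  have cR : 2 ^+ (M ^ k) <= N%:R * (C3%:R * l ^+ (2 * k + 2)) ^+ k.+2 :> R.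
    by rewrite -!natrX -natrM -natrX -natrM ler_nat.
  have N0R : 0 < N%:R :> R by rewrite ltr0n.
  have C3R : 0 < C3%:R :> R by rewrite ltr0n.
  have lp : 0 < l ^+ (2 * k + 2) by rewrite exprn_gt0.
  have Clp : 0 < C3%:R * l ^+ (2 * k + 2) by rewrite mulr_gt0.
  have Clpk : 0 < (C3%:R * l ^+ (2 * k + 2)) ^+ k.+2 by rewrite exprn_gt0.
  have p2 : 0 < 2 ^+ (M ^ k) :> R by rewrite exprn_gt0.
  move: cR; rewrite -ler_ln ?posrE//; last by rewrite mulr_gt0.
  rewrite lnM ?posrE// !lnXn// lnM ?posrE// lnXn//.
  by rewrite -[ln 2 *+ _]mulr_natl -[X in _ <= _ + X]mulr_natl -[ln l *+ _]mulr_natl natrX.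
have Mk : l ^+ k * al <= M%:R ^+ k * ln 2.
  rewrite /al mulrCA mulrC ler_pM2r ?ln_gt0 ?ltr1n// -expr_div_n.
  apply: lerXn2r; rewrite ?nnegrE//; first by rewrite divr_ge0// ltW.
  by rewrite ler_pdivrMr// /l -natrM ler_nat; lia.
have lnl := ln_linear e0 l0.
have lk : l <= l ^+ k by rewrite -{1}[l]expr1 ler_eXn2l// ltr1n.
have Ee : E * eps = al / 4 by rewrite /eps; field; rewrite gt_eqF.
have main : l ^+ k <= 2 / al * ln N%:R.
  rewrite mulrAC ler_pdivlMr//.
  have h1 : k.+2%:R * (ln C3%:R + (2 * k + 2)%:R * ln l) <= al / 4 * l + K.
    rewrite mulrDr mulrA -/E /K -Ee.
    have := ler_wpM2l (ltW E0) lnl; lra.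
  have h2 : K <= al / 4 * l by move: LK; rewrite ler_pdivrMr//; rewrite -/l; lra.
  have h3 : al * l <= al * l ^+ k by rewrite ler_pM2l.
  lra.
have C1R : 1 <= C1%:R :> R by rewrite ler1n.
apply: (@le_trans _ _ ((2 * C1%:R) ^+ k * l ^+ k)); last first.
  by rewrite -mulrA ler_wpM2l// exprn_ge0.
pose y : R := 2 * C1%:R * l.
have y0 : 0 <= y by rewrite !mulr_ge0// ltW.
have my : m%:R <= y ^+ k.+2.
  apply: (@le_trans _ _ (C1 * M.+2 ^ k.+2)%:R); first by rewrite ler_nat ltnW.
  rewrite natrM natrX.
  apply: (@le_trans _ _ (C1%:R ^+ k.+2 * M.+2%:R ^+ k.+2)).
    by apply: ler_wpM2r; rewrite ?exprn_ge0// ler_eXnr.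
  rewrite -exprMn lerXn2r ?nnegrE ?mulr_ge0//.
  rewrite /y mulrAC mulrC ler_wpM2r// /l -natrM ler_nat; lia.
apply: (@le_trans _ _ ((y ^+ k.+2) `^ (k%:R / (k%:R + 2)))).
  by apply: ge0_ler_powR; rewrite ?nnegrE ?divr_ge0 ?addr_ge0 ?exprn_ge0.
rewrite -powR_mulrn// -powRrM (_ : k.+2%:R * _ = k%:R); last first.
  by rewrite -addn2 natrD; field; rewrite gt_eqF// ltr_wpDl.
by rewrite powR_mulrn// /y exprMn.
Qed.
End Asymptotics.

(* For d = 1, and for small m in any dimension (already m = 1, where the
   simplices form the only class), the count is at most 1 and its logarithm is
   not positive; hence d >= 2 and a threshold m0 on m. *)
Theorem theorem3p2 (R : realType) (d : nat) (hd : (1 < d)%N) :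
  exists (c : R) (m0 : nat), forall m : nat, (m0 <= m)%N ->
    m%:R `^ ((d%:R - 1) / (d%:R + 1)) <= c * ln (num_classes R d m)%:R.
Proof.
case: d hd => [//|k]; rewrite ltnS => k0.
have [c [m0 H]] := asymptotic_bound R k0.
exists c, m0 => m /H.
by rewrite -[in X in _ -> X]natr1 addrK -addrA (_ : 1 + 1 = 2).
Qed.
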